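(* Let $\{X_i\}_{i=-\infty}^\infty$ be a strictly stationary $\beta$-mixing sequence with values in $\mathcal X$ and let $\Xi_{i,n}=\Xi_n(X_i)$ for each $i$, where $\Xi_n:\mathcal X\to\mathbb R^{d_1\times d_2}$ is a sequence of measurable $d_1\times d_2$ matrix-valued functions. Assume $E[\Xi_{i,n}]=0$ and $\|\Xi_{i,n}\|\le R_n$ for each $i$ and define $$s_n^2=\max_{1\le i,j\le n}\max\{\|E[\Xi_{i,n}\Xi_{j,n}']\|,\|E[\Xi_{i,n}'\Xi_{j,n}]\|\}.$$ Let $q$ be an integer between $1$ and $n/2$ and let $I_r=\{q[n/q]+1,\dots,n\}$ when $q[n/q]<n$ and $I_r=\emptyset$ when $q[n/q]=n$. Then for all $t\ge0$, $$\mathbb P\left(\left\|\sum_{i=1}^n\Xi_{i,n}\right\|\ge6t\right)\le\frac nq\beta(q)+\mathbb P\left(\left\|\sum_{i\in I_r}\Xi_{i,n}\right\|\ge t\right)+2(d_1+d_2)\exp\left(\frac{-t^2/2}{nqs_n^2+qR_nt/3}\right)$$ (where $\|\sum_{i\in I_r}\Xi_{i,n}\|:=0$ whenever $I_r=\emptyset$).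
   Context: $\|\cdot\|$ is the spectral norm of a matrix and $[\cdot]$ the integer part. For $\sigma$-algebras $\mathcal A,\mathcal B$, $2\beta(\mathcal A,\mathcal B)=\sup\sum_{(i,j)\in I\times J}|\mathbb P(A_i\cap B_j)-\mathbb P(A_i)\mathbb P(B_j)|$, the supremum over all finite partitions $\{A_i\}_{i\in I}\subset\mathcal A$ and $\{B_j\}_{j\in J}\subset\mathcal B$ of the sample space. The $q$th $\beta$-mixing coefficient of $\{X_i\}$ is $\beta(q)=\sup_i\beta(\sigma(\dots,X_{i-1},X_i),\sigma(X_{i+q},X_{i+q+1},\dots))$; the sequence is $\beta$-mixing if $\beta(q)\to0$ as $q\to\infty$. *)

(* Defs.v *)
From HB Require Import structures.
From mathcomp Require Import all_boot all_order all_algebra.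
From mathcomp Require Import all_classical all_reals all_analysis.

Set Implicit Arguments.
Unset Strict Implicit.
Unset Printing Implicit Defensive.

Import Order.TTheory GRing.Theory Num.Theory.
Import numFieldNormedType.Exports.

Local Open Scope classical_set_scope.
Local Open Scope ring_scope.

Definition euclidean_norm (R : realType) (m : nat) (x : 'cV[R]_m) : R :=
  Num.sqrt (\sum_(i < m) x i 0 ^+ 2).

(* The operator norm induced by the Euclidean norms. The norm that the library
   puts on matrices is the largest absolute value of an entry. *)
Definition spectral_norm (R : realType) (m n : nat) (A : 'M[R]_(m, n)) : R :=
  sup [set euclidean_norm (A *m x) | x in [set x | euclidean_norm x <= 1]].

(* Measurability for the Borel sigma-algebra of the space of matrices. *)
Definition measurable_mx d (T : measurableType d) (R : realType) (m n : nat)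
    (M : T -> 'M[R]_(m, n)) : Prop :=
  forall i j, measurable_fun [set: T] (fun w => M w i j).

(* [fine] sends infinite expectations to 0; only meaningful for matrices with
   integrable entries. *)
Definition expectation_mx d (T : measurableType d) (R : realType)
    (P : probability T R) (m n : nat) (M : T -> 'M[R]_(m, n)) : 'M[R]_(m, n) :=
  \matrix_(i, j) fine ('E_P[fun w => M w i j])%E.

(* The finite-dimensional laws, on the product sigma-algebras, are invariant
   under time shifts. *)
Definition strictly_stationary d (T : measurableType d) (R : realType)
    (P : probability T R) dU (U : measurableType dU) (X : int -> T -> U) :
    Prop :=
  forall (k : nat) (t : 'I_k -> int) (h : int) (B : set (k.-tuple U)),
    measurable B ->
    pushforward P (fun w => [tuple X (t i + h) w | i < k]) B =
    pushforward P (fun w => [tuple X (t i) w | i < k]) B.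

Definition sigma_process (T : Type) dU (U : measurableType dU)
    (X : int -> T -> U) (K : set int) : set (set T) :=
  <<s \bigcup_(k in K) preimage_set_system [set: T] (X k) measurable >>.

Definition beta_dep d (T : measurableType d) (R : realType)
    (P : probability T R) (FA FB : set (set T)) : \bar R :=
  ((2^-1)%:E * ereal_sup [set x : \bar R |
    exists (m n : nat) (A : 'I_m -> set T) (B : 'I_n -> set T),
      [/\ partition [set: 'I_m] A [set: T], forall i, FA (A i),
          partition [set: 'I_n] B [set: T], forall j, FB (B j) &
          x = \sum_(i < m) \sum_(j < n)
                `|P (A i `&` B j) - P (A i) * P (B j)|]])%E.

Definition beta_coef d (T : measurableType d) (R : realType)
    (P : probability T R) dU (U : measurableType dU) (X : int -> T -> U)
    (q : nat) : \bar R :=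
  ereal_sup [set beta_dep P
      (sigma_process X [set k | k <= i])
      (sigma_process X [set k | i + q%:Z <= k]) | i in [set: int]].

Definition beta_mixing d (T : measurableType d) (R : realType)
    (P : probability T R) dU (U : measurableType dU) (X : int -> T -> U) :
    Prop :=
  beta_coef P X q @[q --> \oo] --> 0%E.

(* The quantity [s_n ^ 2] for the random matrices [M 1, ..., M n]; the [0] in
   the iterated maxima is harmless, the norms being nonnegative. *)
Definition s2 d (T : measurableType d) (R : realType) (P : probability T R)
    (d1 d2 : nat) (M : nat -> T -> 'M[R]_(d1, d2)) (n : nat) : R :=
  \big[Num.max/0]_(1 <= i < n.+1) \big[Num.max/0]_(1 <= j < n.+1)
    Num.max
      (spectral_norm (expectation_mx P (fun w => M i w *m (M j w)^T)))
      (spectral_norm (expectation_mx P (fun w => (M i w)^T *m M j w))).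

(* Main.v *)
(* Cut {1, ..., n} into blocks of length q, plus a remainder, and treat the even
   and the odd blocks separately: ||sum|| >= 6t forces ||remainder|| >= t or one
   of the two block sums to have norm >= 5t/2.

   Instead of coupling, the matrix values are discretised. The block sums then
   depend on finitely valued variables Y_k, and testing the mixing condition on
   the partitions generated by the past and by Y_k shows that replacing Y_k by an
   independent copy changes the mean of a [0, 1]-valued function by at most
   beta(q).

   For independent blocks, the Laplace transform method bounds E tr exp(theta H),
   H being the Hermitian dilation of the sum, with the Golden-Thompson inequality.
   Since s_n^2 bounds every term E[Xi_i Xi_j'], each block has second moment at most
   q^2 s_n^2, so that the Ahlswede-Winter variance (the sum of the norms of the
   second moments of the blocks) is enough. The gap between 5t/2 and t
   absorbs the discretisation error and the loss in the constants. The exponential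
   exp(A) is replaced by (1 + A/N)^N with N a power of two: for those N, the bound
   tr (A B)^N <= tr A^N B^N follows from the Cauchy-Schwarz inequality alone, and no
   spectral theorem is used. *)
Require Import Defs.
From HB Require Import structures.
From mathcomp Require Import all_boot all_order all_algebra.
From mathcomp Require Import all_classical all_reals all_analysis.
From mathcomp Require Import measurable_realfun.
From mathcomp Require Import ring lra zify.

Set Implicit Arguments.
Unset Strict Implicit.
Unset Printing Implicit Defensive.

Import Order.TTheory GRing.Theory Num.Theory.
Import numFieldNormedType.Exports.

Local Open Scope classical_set_scope.
Local Open Scope ring_scope.

(** * Euclidean and spectral norms *)

Section euclidean.
Context {R : realType}.

(** Lagrange's identity: twice the difference of the two sides is the double sum of the squares
    [(a i * b j - a j * b i) ^+ 2]. *)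
Lemma sum_cauchy_schwarz (I : finType) (a b : I -> R) :
  (\sum_i a i * b i) ^+ 2 <= (\sum_i a i ^+ 2) * (\sum_i b i ^+ 2).
Proof.
have E : \sum_i \sum_j (a i * b j - a j * b i) ^+ 2 =
   ((\sum_i a i ^+ 2) * (\sum_i b i ^+ 2) - (\sum_i a i * b i) ^+ 2) *+ 2.
  transitivity (\sum_i \sum_j a i ^+ 2 * b j ^+ 2 +
      \sum_i \sum_j a j ^+ 2 * b i ^+ 2 -
      (\sum_i \sum_j a i * b i * (a j * b j)) *+ 2).
    rewrite -sumrMnl -big_split /= -sumrB; apply: eq_bigr => i _.
    rewrite -sumrMnl -big_split /= -sumrB; apply: eq_bigr => j _; ring.
  rewrite [X in _ + X - _]exchange_big /= -!big_distrlr /=; ring.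
rewrite -subr_ge0 -(pmulrn_lge0 _ (ltn0Sn 1)) -E.
by apply: sumr_ge0 => i _; apply: sumr_ge0 => j _; exact: sqr_ge0.
Qed.

Definition dot (m : nat) (x y : 'cV[R]_m) : R := \sum_(i < m) x i 0 * y i 0.

Lemma dotC m (x y : 'cV[R]_m) : dot x y = dot y x.
Proof. by apply: eq_bigr => i _; rewrite mulrC. Qed.

Lemma dotDr m (x y z : 'cV[R]_m) : dot x (y + z) = dot x y + dot x z.
Proof. by rewrite -big_split; apply: eq_bigr => i _; rewrite mxE mulrDr. Qed.

Lemma dotDl m (x y z : 'cV[R]_m) : dot (y + z) x = dot y x + dot z x.
Proof. by rewrite dotC dotDr !(dotC x). Qed.

Lemma dotZr m a (x y : 'cV[R]_m) : dot x (a *: y) = a * dot x y.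
Proof. by rewrite mulr_sumr; apply: eq_bigr => i _; rewrite mxE mulrCA. Qed.

Lemma dotZl m a (x y : 'cV[R]_m) : dot (a *: x) y = a * dot x y.
Proof. by rewrite dotC dotZr dotC. Qed.

Lemma dot0r m (x : 'cV[R]_m) : dot x 0 = 0.
Proof. by rewrite -(scale0r 0) dotZr mul0r. Qed.

Lemma dot_sumr m (x : 'cV[R]_m) (I : Type) (r : seq I) (P : pred I) F :
  dot x (\sum_(i <- r | P i) F i) = \sum_(i <- r | P i) dot x (F i).
Proof.
by elim/big_rec2: _ => [|i u v _ <-]; rewrite ?dot0r// dotDr.
Qed.

Lemma dot_mulmx m n (A : 'M[R]_(m, n)) x y : dot (A *m x) y = dot x (A^T *m y).
Proof.
rewrite /dot; under eq_bigr do rewrite mxE mulr_suml.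
rewrite exchange_big /=; apply: eq_bigr => j _; rewrite mxE mulr_sumr.
by apply: eq_bigr => i _; rewrite mxE; ring.
Qed.

Lemma dot_col_mx m n (x1 y1 : 'cV[R]_m) (x2 y2 : 'cV[R]_n) :
  dot (col_mx x1 x2) (col_mx y1 y2) = dot x1 y1 + dot x2 y2.
Proof.
rewrite /dot big_split_ord /=; congr (_ + _); apply: eq_bigr => i _.
  by rewrite !col_mxEu.
by rewrite !col_mxEd.
Qed.

Local Notation nrm := (@euclidean_norm R _).

Lemma euclidean_norm_ge0 m (x : 'cV[R]_m) : 0 <= nrm x.
Proof. exact: sqrtr_ge0. Qed.
Local Hint Resolve euclidean_norm_ge0 : core.

Lemma sqr_euclidean_norm m (x : 'cV[R]_m) : nrm x ^+ 2 = dot x x.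
Proof.
rewrite sqr_sqrtr; last by apply: sumr_ge0 => i _; exact: sqr_ge0.
by apply: eq_bigr => i _; rewrite expr2.
Qed.

Lemma dot_cauchy_schwarz m (x y : 'cV[R]_m) : `|dot x y| <= nrm x * nrm y.
Proof.
rewrite -(@ler_pXn2r _ 2) ?nnegrE ?mulr_ge0// real_normK ?num_real//.
rewrite exprMn !sqr_euclidean_norm.
by have := sum_cauchy_schwarz (fun i => x i 0) (fun i => y i 0); rewrite /dot.
Qed.

Lemma euclidean_normD m (x y : 'cV[R]_m) : nrm (x + y) <= nrm x + nrm y.
Proof.
rewrite -(@ler_pXn2r _ 2) ?nnegrE ?addr_ge0//.
rewrite sqr_euclidean_norm dotDr !dotDl -!sqr_euclidean_norm (dotC y x).
have := ler_norm (dot x y); have := dot_cauchy_schwarz x y; nra.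
Qed.

Lemma euclidean_normZ m a (x : 'cV[R]_m) : nrm (a *: x) = `|a| * nrm x.
Proof.
apply/eqP; rewrite -(@eqrXn2 _ 2) ?mulr_ge0//.
by rewrite exprMn real_normK ?num_real// !sqr_euclidean_norm dotZr dotZl; apply/eqP; ring.
Qed.

Lemma euclidean_norm0 m : nrm (0 : 'cV[R]_m) = 0.
Proof. by rewrite -(scale0r 0) euclidean_normZ normr0 mul0r. Qed.

Lemma euclidean_norm_eq0 m (x : 'cV[R]_m) : nrm x = 0 -> x = 0.
Proof.
move=> x0; have : dot x x = 0 by rewrite -sqr_euclidean_norm x0 expr0n.
move/eqP; rewrite psumr_eq0 => [/allP h|i _]; last by rewrite -expr2 sqr_ge0.
apply/colP => i; have := h i (mem_index_enum i).
by rewrite mxE /= mulf_eq0 orbb => /eqP.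
Qed.

Lemma normr_entry_le m (x : 'cV[R]_m) i : `|x i 0| <= nrm x.
Proof.
rewrite -(@ler_pXn2r _ 2) ?nnegrE// real_normK ?num_real// sqr_euclidean_norm.
rewrite /dot (bigD1 i)//= -expr2 lerDl.
by apply: sumr_ge0 => j _; rewrite -expr2 sqr_ge0.
Qed.

Lemma euclidean_norm_le_sum m (x : 'cV[R]_m) : nrm x <= \sum_i `|x i 0|.
Proof.
have s0 : 0 <= \sum_i `|x i 0| by apply: sumr_ge0.
rewrite -(@ler_pXn2r _ 2) ?nnegrE// sqr_euclidean_norm expr2 mulr_suml.
apply: ler_sum => i _; rewrite -expr2 -real_normK ?num_real// expr2.
by rewrite ler_wpM2l// (bigD1 i)//= lerDl sumr_ge0.
Qed.

(** An inequality over all vectors instead of a supremum, so that sums, products and powers are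
    bounded directly. *)
Definition op_bound m n (A : 'M[R]_(m, n)) (c : R) : Prop :=
  forall y, nrm (A *m y) <= c * nrm y.

Lemma op_boundW m n (A : 'M[R]_(m, n)) c c' :
  op_bound A c -> c <= c' -> op_bound A c'.
Proof. by move=> Ac cc y; apply: le_trans (Ac y) _; rewrite ler_wpM2r. Qed.

Lemma op_boundD m n (A B : 'M[R]_(m, n)) c e :
  op_bound A c -> op_bound B e -> op_bound (A + B) (c + e).
Proof.
move=> Ac Be y; rewrite mulmxDl mulrDl.
by apply: le_trans (euclidean_normD _ _) _; rewrite lerD.
Qed.

Lemma op_boundZ m n a (A : 'M[R]_(m, n)) c :
  op_bound A c -> op_bound (a *: A) (`|a| * c).
Proof.
by move=> Ac y; rewrite -scalemxAl euclidean_normZ -mulrA ler_wpM2l.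
Qed.

Lemma op_bound0 m n : op_bound (0 : 'M[R]_(m, n)) 0.
Proof. by move=> y; rewrite mul0mx euclidean_norm0 mul0r. Qed.

Lemma op_bound_sum m n (I : Type) (r : seq I) (P : pred I) (A : I -> 'M[R]_(m, n)) c :
  (forall i, P i -> op_bound (A i) (c i)) ->
  op_bound (\sum_(i <- r | P i) A i) (\sum_(i <- r | P i) c i).
Proof.
move=> Ac; elim/big_rec2: _ => [|i u v Pi h]; first exact: op_bound0.
by apply: op_boundD => //; exact: Ac.
Qed.

Lemma op_boundM m n p (A : 'M[R]_(m, n)) (B : 'M[R]_(n, p)) c e :
  0 <= c -> op_bound A c -> op_bound B e -> op_bound (A *m B) (c * e).
Proof.
move=> c0 Ac Be y; rewrite -mulmxA -mulrA.
by apply: le_trans (Ac _) _; rewrite ler_wpM2l.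
Qed.

Lemma op_bound1 n : op_bound (1 : 'M[R]_n) 1.
Proof. by move=> y; rewrite mul1mx mul1r. Qed.

Lemma op_boundX n (A : 'M[R]_n) c k :
  0 <= c -> op_bound A c -> op_bound (A ^+ k) (c ^+ k).
Proof.
move=> c0 Ac; elim: k => [|k IH]; first exact: op_bound1.
by rewrite !exprS; exact: op_boundM.
Qed.

Lemma op_bound_dot m n (A : 'M[R]_(m, n)) c x y :
  op_bound A c -> `|dot x (A *m y)| <= c * nrm x * nrm y.
Proof.
move=> Ac; apply: le_trans (dot_cauchy_schwarz _ _) _.
by rewrite (mulrC c) -mulrA ler_wpM2l.
Qed.

(** Cauchy-Schwarz in [nrm (A^T *m y) ^+ 2 = dot y (A *m (A^T *m y))], then division by
    [nrm (A^T *m y)]. *)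
Lemma op_boundT m n (A : 'M[R]_(m, n)) c :
  0 <= c -> op_bound A c -> op_bound A^T c.
Proof.
move=> c0 Ac y; have [->|n0] := eqVneq (nrm (A^T *m y)) 0; first exact: mulr_ge0.
have {}n0 : 0 < nrm (A^T *m y) by rewrite lt_neqAle eq_sym n0 euclidean_norm_ge0.
rewrite -(ler_pM2r n0) -expr2 sqr_euclidean_norm dot_mulmx trmxK.
by apply: le_trans (ler_norm _) _; apply: le_trans (op_bound_dot _ _ Ac) _; lra.
Qed.

Lemma op_bound_entry m n (A : 'M[R]_(m, n)) c i j : op_bound A c -> `|A i j| <= c.
Proof.
move=> Ac; have := Ac (delta_mx j 0).
have -> : nrm (delta_mx j 0 : 'cV[R]_n) = 1.
  rewrite /euclidean_norm (bigD1 j)//= mxE !eqxx expr1n big1 ?addr0 ?sqrtr1//.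
  by move=> k kj; rewrite mxE (negPf kj) expr0n.
rewrite mulr1 -colE; apply: le_trans.
by have := normr_entry_le (col j A) i; rewrite mxE.
Qed.

Lemma norm_mxtrace_le n (A : 'M[R]_n) c : op_bound A c -> `|\tr A| <= n%:R * c.
Proof.
move=> Ac; apply: le_trans (ler_norm_sum _ _ _) _.
rewrite -[n in leRHS]card_ord mulr_natl -sumr_const.
by apply: ler_sum => i _; exact: op_bound_entry.
Qed.

(** Comparison with the sum of the absolute values of the coordinates. The crude factor is harmless:
    the lemma serves to show that some bound exists and to control errors that can be made
    arbitrarily small. *)
Lemma op_bound_of_entries m n (A : 'M[R]_(m, n)) e :
  0 <= e -> (forall i j, `|A i j| <= e) -> op_bound A (e * (m * n)%:R).
Proof.
move=> e0 Ae y; apply: le_trans (euclidean_norm_le_sum _) _.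
have -> : e * (m * n)%:R * nrm y = \sum_(i < m) \sum_(j < n) e * nrm y.
  by rewrite !sumr_const !card_ord -mulrnA mulnC -mulr_natr; ring.
apply: ler_sum => i _; rewrite mxE; apply: le_trans (ler_norm_sum _ _ _) _.
by apply: ler_sum => j _; rewrite normrM ler_pM// normr_entry_le.
Qed.

Lemma op_bound_exists m n (A : 'M[R]_(m, n)) : exists2 c, 0 <= c & op_bound A c.
Proof.
have h i j : `|A i j| <= \sum_i \sum_j `|A i j|.
  rewrite (bigD1 i)//= (bigD1 j)//= -addrA lerDl addr_ge0 ?sumr_ge0// => k _.
  exact: sumr_ge0.
exists (\sum_i \sum_j `|A i j| * (m * n)%:R).
  by apply: sumr_ge0 => i _; apply: sumr_ge0 => j _; rewrite mulr_ge0.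
have -> : \sum_i \sum_j `|A i j| * (m * n)%:R = (\sum_i \sum_j `|A i j|) * (m * n)%:R.
  by rewrite mulr_suml; apply: eq_bigr => i _; rewrite mulr_suml.
by apply: op_bound_of_entries => //; apply: sumr_ge0 => i _; apply: sumr_ge0.
Qed.

Local Notation sn := (@spectral_norm R _ _).

Lemma has_sup_spectral_norm m n (A : 'M[R]_(m, n)) :
  has_sup [set nrm (A *m x) | x in [set x | nrm x <= 1]].
Proof.
split; first by exists (nrm (A *m 0)), 0; rewrite //= euclidean_norm0.
have [c c0 Ac] := op_bound_exists A.
exists c => _ [x /= x1 <-]; apply: le_trans (Ac x) _.
by rewrite -[leRHS]mulr1 ler_wpM2l.
Qed.

Lemma spectral_norm_ge0 m n (A : 'M[R]_(m, n)) : 0 <= sn A.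
Proof.
have := ub_le_sup (proj2 (has_sup_spectral_norm A)) (x := nrm (A *m 0)).
rewrite mulmx0 euclidean_norm0; apply; exists 0; rewrite /= ?mulmx0 euclidean_norm0//.
Qed.

Lemma op_bound_spectral_norm m n (A : 'M[R]_(m, n)) : op_bound A (sn A).
Proof.
move=> y; have [y0|n0] := eqVneq (nrm y) 0.
  by rewrite (euclidean_norm_eq0 y0) mulmx0 !euclidean_norm0 mulr0.
have {}n0 : 0 < nrm y by rewrite lt_neqAle eq_sym n0 euclidean_norm_ge0.
rewrite -ler_pdivrMr// mulrC -{1}(ger0_norm (ltW n0)) -normrV ?unitfE ?gt_eqF//.
rewrite -euclidean_normZ scalemxAr.
apply: (ub_le_sup (has_sup_spectral_norm A).2).
exists ((nrm y)^-1 *: y) => //=.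
by rewrite euclidean_normZ ger0_norm ?invr_ge0 ?(ltW n0)// mulVf ?gt_eqF.
Qed.

Lemma spectral_norm_le m n (A : 'M[R]_(m, n)) c :
  0 <= c -> op_bound A c -> sn A <= c.
Proof.
move=> c0 Ac; apply: ge_sup; first exact: (has_sup_spectral_norm A).1.
move=> _ [x /= x1 <-]; apply: le_trans (Ac x) _.
by rewrite -[leRHS]mulr1 ler_wpM2l.
Qed.

Lemma spectral_normD m n (A B : 'M[R]_(m, n)) : sn (A + B) <= sn A + sn B.
Proof.
apply: spectral_norm_le; first by rewrite addr_ge0 ?spectral_norm_ge0.
by apply: op_boundD; exact: op_bound_spectral_norm.
Qed.

Lemma spectral_norm_gt m n (A : 'M[R]_(m, n)) x :
  x < sn A -> exists2 y, nrm y <= 1 & x < nrm (A *m y).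
Proof.
move=> xA; have [_ [y /= y1 <-] h] := sup_gt (has_sup_spectral_norm A).1 xA.
by exists y.
Qed.

(** * Trace inequalities *)

Lemma mxtrace_mul_trmx d (A : 'M[R]_d) : \tr (A * A^T) = \sum_(p : 'I_d * 'I_d) A p.1 p.2 ^+ 2.
Proof.
rewrite -(pair_bigA _ (fun i j => A i j ^+ 2)) /=; apply: eq_bigr => i _.
by rewrite mxE; apply: eq_bigr => j _; rewrite mxE expr2.
Qed.

Lemma trmxX d (A : 'M[R]_d) n : (A ^+ n)^T = A^T ^+ n.
Proof.
elim: n => [|n IH]; first exact: trmx1.
by rewrite exprS exprSr -!mulmxE trmx_mul IH.
Qed.

(** For [k > 0] the power is again a Gram matrix [B * B^T], with [B] the half power. *)
Lemma mxtrace_gram_expr_ge0 d (A : 'M[R]_d) k : 0 <= \tr ((A * A^T) ^+ (2 ^ k)).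
Proof.
case: k => [|k]; first by rewrite expr1 mxtrace_mul_trmx sumr_ge0 // => p _; exact: sqr_ge0.
rewrite expnS mul2n -addnn exprD -{2}[A * A^T]trmxK -trmxX trmx_mul trmxK mulmxE.
by rewrite mxtrace_mul_trmx sumr_ge0 // => p _; exact: sqr_ge0.
Qed.

Lemma mxtrace_cauchy_schwarz d (A B : 'M[R]_d) :
  \tr (A * B) ^+ 2 <= \tr (A * A^T) * \tr (B * B^T).
Proof.
have -> : \tr (A * B) = \sum_(p : 'I_d * 'I_d) A p.1 p.2 * B^T p.1 p.2.
  rewrite -(pair_bigA _ (fun i j => A i j * B^T i j)) /=; apply: eq_bigr => i _.
  by rewrite mxE; apply: eq_bigr => j _; rewrite mxE.
have -> : \tr (B * B^T) = \tr (B^T * B^T^T) by rewrite trmxK mxtrace_mulC.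
by rewrite !mxtrace_mul_trmx; exact: sum_cauchy_schwarz.
Qed.

Lemma exprMS_rot (S : pzSemiRingType) (x y : S) n :
  (x * y) ^+ n.+1 = x * (y * x) ^+ n * y.
Proof.
elim: n => [|n IH]; first by rewrite mulr1 expr1.
by rewrite exprS IH (exprS (y * x)) !mulrA.
Qed.

Lemma mxtrace_exprM d (A B : 'M[R]_d) n : \tr ((A * B) ^+ n) = \tr ((B * A) ^+ n).
Proof.
case: n => [//|n]; rewrite exprMS_rot mxtrace_mulC mulmxE.
by rewrite exprS mulrA.
Qed.

Lemma prodr_pair (S : pzSemiRingType) (Y : nat -> S) n :
  \prod_(0 <= i < 2 * n) Y i = \prod_(0 <= j < n) (Y (2 * j)%N * Y (2 * j).+1).
Proof.
elim: n => [|n IH]; first by rewrite !big_nil.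
by rewrite mulnS !addSn add0n !big_nat_recr//= -?mulrA IH.
Qed.

(* Cauchy-Schwarz makes the claim self-improving under doubling the number of
   factors: after pairing them, [tr (Z Z^T) ^ n] for [Z = Y1 Y2] is the trace of
   an alternating product of [Y1^T Y1] and [Y2 Y2^T]. *)
Lemma mxtrace_prod_le d k (Y : nat -> 'M[R]_d) c :
  (forall i, \tr ((Y i * (Y i)^T) ^+ (2 ^ k)) <= c) ->
  `|\tr (\prod_(0 <= i < 2 ^ k.+1) Y i)| <= c.
Proof.
move=> Yc; have c0 : 0 <= c := le_trans (mxtrace_gram_expr_ge0 _ _) (Yc 0%N).
elim: k Y Yc => [|k IH] Y Yc.
  rewrite big_nat_recr//= big_nat1.
  rewrite -(@ler_pXn2r _ 2) ?nnegrE// real_normK ?num_real//.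
  apply: le_trans (mxtrace_cauchy_schwarz _ _) _; rewrite expr2.
  have h i : 0 <= \tr (Y i * (Y i)^T) <= c.
    rewrite mxtrace_mul_trmx sumr_ge0 => [/=|p _]; last exact: sqr_ge0.
    by rewrite -mxtrace_mul_trmx -[X in \tr X]expr1 Yc.
  by rewrite ler_pM//; have /andP[] := h 0%N; have /andP[] := h 1%N.
rewrite expnS prodr_pair; apply: (IH _ _) => j.
set Y1 := Y _; set Y2 := Y _.
rewrite trmx_mul -mulmxE -!mulmxA mulmxE -/(_ * _) mxtrace_exprM.
have -> : Y2 * (Y2^T * Y1^T) * Y1 = (Y2 * Y2^T) * (Y1^T * Y1) by rewrite !mulrA.
pose W i := if odd i then Y1^T * Y1 else Y2 * Y2^T.
have -> : (Y2 * Y2^T * (Y1^T * Y1)) ^+ (2 ^ k) = \prod_(0 <= i < 2 ^ k.+1) W i.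
  rewrite expnS prodr_pair /W.
  under eq_bigr do rewrite /= mul2n odd_double /=.
  by rewrite big_const_nat subn0 -Monoid.iteropE.
(* Second use of the induction hypothesis. Each [W i] is a symmetric Gram matrix, so the power
   [2 ^ k] of [W i * (W i)^T] is its power [2 ^ k.+1], which the assumption on [Y] controls. *)
apply: le_trans (ler_norm _) (IH _ _) => i.
have E (A : 'M[R]_d) : (A * A) ^+ (2 ^ k) = A ^+ (2 ^ k.+1) by rewrite -expr2 -exprM expnS.
rewrite /W; case: ifP => _; rewrite trmx_mul trmxK mulmxE E.
  by rewrite mxtrace_exprM; exact: Yc.
exact: Yc.
Qed.

(** A Lieb-Thirring inequality. With all factors equal to [A * B], [mxtrace_prod_le] passes from the
    power [2 ^ k.+1] of [A * B] to the power [2 ^ k] of [A ^+ 2 * B ^+ 2], and the induction goes on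
    with the squares. *)
Lemma mxtrace_expr_mul_le d k (A B : 'M[R]_d) : A^T = A -> B^T = B ->
  \tr ((A * B) ^+ (2 ^ k)) <= \tr (A ^+ (2 ^ k) * B ^+ (2 ^ k)).
Proof.
elim: k A B => [|k IH] A B As Bs; first by rewrite !expr1.
apply: (@le_trans _ _ (\tr ((A ^+ 2 * B ^+ 2) ^+ (2 ^ k)))).
  apply: le_trans (ler_norm _) _.
  have -> : (A * B) ^+ (2 ^ k.+1) = \prod_(0 <= i < 2 ^ k.+1) (A * B).
    by rewrite big_const_nat subn0 -Monoid.iteropE.
  have E : \tr ((A * B * (A * B)^T) ^+ (2 ^ k)) = \tr ((A ^+ 2 * B ^+ 2) ^+ (2 ^ k)).
    rewrite trmx_mul As Bs mulmxE -mulrA mxtrace_exprM.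
    have -> : B * (B * A) * A = B ^+ 2 * A ^+ 2 by rewrite !expr2 !mulrA.
    exact: mxtrace_exprM.
  by apply: mxtrace_prod_le => i; rewrite E.
apply: le_trans (IH _ _ _ _) _; rewrite -?exprM -?expnS//.
- by rewrite expr2 -mulmxE trmx_mul As.
- by rewrite expr2 -mulmxE trmx_mul Bs.
Qed.

Lemma sum_sqr_mulmx_le m n (A : 'M[R]_(m, n)) u :
  nrm (A *m u) ^+ 2 <= (\sum_i \sum_j A i j ^+ 2) * nrm u ^+ 2.
Proof.
rewrite !sqr_euclidean_norm mulr_suml; apply: ler_sum => i _.
rewrite -expr2 mxE; apply: le_trans (sum_cauchy_schwarz _ _) _.
by rewrite /dot; under [X in _ * X]eq_bigr do rewrite expr2.
Qed.

(** By cyclicity the trace is that of [C * Q * C], a sum of quadratic forms of [Q] at the columns of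
    the symmetric matrix [C]. *)
Lemma mxtrace_sandwich_le d (C Q : 'M[R]_d) lam : C^T = C ->
  (forall u, dot u (Q *m u) <= lam * nrm u ^+ 2) ->
  \tr (C * C * Q) <= lam * \tr (C * C).
Proof.
move=> Cs Qlam.
have trE (B : 'M[R]_d) : \tr (C * B * C) = \sum_i dot (col i C) (B *m col i C).
  apply: eq_bigr => i _; rewrite -mulrA -mulmxE -{1}Cs mxE.
  by apply: eq_bigr => j _; rewrite !mxE; congr (_ * _); apply: eq_bigr => k _; rewrite mxE.
rewrite -mulrA mxtrace_mulC mulmxE.
have -> : \tr (C * C) = \tr (C * 1 * C) by rewrite mulr1.
rewrite !trE mulr_sumr; apply: ler_sum => i _.
by apply: le_trans (Qlam _) _; rewrite mul1mx sqr_euclidean_norm.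
Qed.

(** Repeated squaring: for symmetric [M] and a unit vector [u], Cauchy-Schwarz bounds
    [dot u (M ^+ n *m u) ^+ 2] by [nrm (M ^+ n *m u) ^+ 2], which is the quadratic form of
    [M ^+ (2 * n)] at [u]. *)
Lemma dot_expr_ge d (M : 'M[R]_d) u k : M^T = M -> nrm u = 1 ->
  0 <= dot u (M *m u) ->
  dot u (M *m u) ^+ (2 ^ k) <= dot u (M ^+ (2 ^ k) *m u).
Proof.
move=> Ms u1 Mu; elim: k => [|k IH]; first by rewrite !expr1.
rewrite expnSr exprM.
have -> : dot u (M ^+ (2 ^ k * 2) *m u) = nrm (M ^+ (2 ^ k) *m u) ^+ 2.
  rewrite sqr_euclidean_norm dot_mulmx trmxX Ms mulmxA mulmxE -exprD.
  by rewrite muln2 -addnn.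
apply: le_trans (_ : dot u (M ^+ (2 ^ k) *m u) ^+ 2 <= _).
  by rewrite ler_pXn2r ?nnegrE ?exprn_ge0//; apply: le_trans IH; exact: exprn_ge0.
have := dot_cauchy_schwarz u (M ^+ (2 ^ k) *m u); rewrite u1 mul1r => h.
by rewrite -[leLHS]real_normK ?num_real// ler_pXn2r ?nnegrE.
Qed.

(** Stands in for bounding the largest eigenvalue by the trace: the trace is the squared Frobenius
    norm of [M ^+ (2 ^ k)], which dominates the squared norm of its value at [u]. *)
Lemma mxtrace_expr_ge d (M : 'M[R]_d) u k : M^T = M -> nrm u = 1 ->
  0 <= dot u (M *m u) ->
  dot u (M *m u) ^+ (2 ^ k.+1) <= \tr (M ^+ (2 ^ k.+1)).
Proof.
move=> Ms u1 Mu; apply: le_trans (dot_expr_ge k.+1 Ms u1 Mu) _.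
rewrite expnS mul2n -addnn exprD -{1}Ms -trmxX -mulmxE -mulmxA -dot_mulmx.
rewrite -sqr_euclidean_norm.
apply: le_trans (sum_sqr_mulmx_le _ _) _; rewrite u1 expr1n mulr1.
rewrite -{3}Ms -trmxX mulmxE mxtrace_mul_trmx.
by rewrite -(pair_bigA _ (fun i j => (M ^+ (2 ^ k)) i j ^+ 2)).
Qed.

Let scale_mull d (c : R) (A B : 'M[R]_d) : c *: (A * B) = c *: A * B.
Proof. exact: scalemxAl. Qed.

Let scale_mulr d (c : R) (A B : 'M[R]_d) : c *: (A * B) = A * (c *: B).
Proof. exact: scalemxAr. Qed.

(** Telescoping; [1 <= c] allows [c ^+ n] to be raised to [c ^+ n.+1] at each stage. *)
Lemma op_bound_exprB d (A B : 'M[R]_d) c e n :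
  1 <= c -> 0 <= e -> op_bound A c -> op_bound B c -> op_bound (A - B) e ->
  op_bound (A ^+ n - B ^+ n) (n%:R * c ^+ n * e).
Proof.
move=> c1 e0 Ac Bc ABe; have c0 : 0 <= c := le_trans ler01 c1.
elim: n => [|n IH]; first by rewrite subrr !mul0r; exact: op_bound0.
have -> : A ^+ n.+1 - B ^+ n.+1 = A * (A ^+ n - B ^+ n) + (A - B) * B ^+ n.
  by rewrite !exprS mulrBr mulrBl addrA subrK.
apply: op_boundW (op_boundD (op_boundM c0 Ac IH) (op_boundM e0 ABe (op_boundX n c0 Bc))) _.
rewrite exprS -natr1; have : 0 <= c ^+ n * e by rewrite mulr_ge0 ?exprn_ge0.
nra.
Qed.

(* [\tr ((1 + A / N) ^ N)] stands in for [\tr (exp A)], which keeps every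
   argument polynomial. *)
Definition approx_trexp d (N : nat) (A : 'M[R]_d) : R := \tr ((1 + N%:R^-1 *: A) ^+ N).

Lemma trmx_1Z d (c : R) (A : 'M[R]_d) : A^T = A -> (1 + c *: A)^T = 1 + c *: A.
Proof. by move=> As; rewrite linearD /= linearZ /= As; congr (_ + _); exact: trmx1. Qed.

Lemma op_bound_1Z d (c b : R) (A : 'M[R]_d) : 0 <= c -> op_bound A b -> op_bound (1 + c *: A) (1 + c * b).
Proof.
move=> c0 Ab; apply: op_boundD; first exact: op_bound1.
by rewrite -{2}(ger0_norm c0); exact: op_boundZ.
Qed.

Lemma expr_1Ddiv_le (b : R) N : 0 <= b -> (1 + N%:R^-1 * b) ^+ N <= expR b.
Proof.
move=> b0; case: N => [|N]; first by rewrite expr0 -expR0 ler_expR.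
have -> : expR b = expR (N.+1%:R^-1 * b) ^+ N.+1.
  by rewrite -expRM_natl mulrA divff ?mul1r// pnatr_eq0.
by rewrite ler_pXn2r ?nnegrE ?expR_ge0 ?expR_ge1Dx// addr_ge0// mulr_ge0// invr_ge0.
Qed.

(** Golden-Thompson up to an error of order [1 / N]: [1 + (S + X) / N] and
    [(1 + S / N) * (1 + X / N)] differ by [S * X / N ^ 2], so their [N]-th powers differ by a
    multiple of [1 / N], and [mxtrace_expr_mul_le] splits the power of the product. *)
Lemma approx_trexpD_le d N k (S X : 'M[R]_d) b : N = (2 ^ k)%N -> 0 <= b ->
  op_bound S b -> op_bound X b -> S^T = S -> X^T = X ->
  approx_trexp N (S + X) <=
    \tr ((1 + N%:R^-1 *: S) ^+ N * (1 + N%:R^-1 *: X) ^+ N)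
    + d%:R * (b ^+ 2 * expR (2 * b) / N%:R).
Proof.
move=> Nk b0 Sb Xb Ss Xs; rewrite /approx_trexp; set c := N%:R^-1.
have N0 : N%:R != 0 :> R by rewrite Nk pnatr_eq0 -lt0n expn_gt0.
have c0 : 0 <= c by rewrite invr_ge0.
set A := 1 + c *: S; set B := 1 + c *: X; set Q := 1 + c *: (S + X).
have QAB : Q - A * B = - c ^+ 2 *: (S * X).
  rewrite /Q /A /B mulrDl mul1r mulrDr mulr1 -scale_mull -scale_mulr scalerA.
  rewrite scalerDr expr2 scaleNr; move: (c *: S) (c *: X) (_ *: (S * X)) => U V W.
  by apply/matrixP => i j; rewrite !mxE; ring.
have Qb : op_bound Q ((1 + c * b) ^+ 2).
  apply: op_boundW (op_bound_1Z c0 (op_boundD Sb Xb)) _.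
  by rewrite sqrrD expr1n mul1r; have := sqr_ge0 (c * b); lra.
have ABb : op_bound (A * B) ((1 + c * b) ^+ 2).
  rewrite expr2; apply: op_boundM; rewrite ?addr_ge0 ?mulr_ge0//; exact: op_bound_1Z.
have c1 : 1 <= (1 + c * b) ^+ 2 by rewrite exprn_ege1// lerDl mulr_ge0.
have e0 : 0 <= c ^+ 2 * (b * b) by rewrite !mulr_ge0 ?sqr_ge0.
have Db : op_bound (Q - A * B) (c ^+ 2 * (b * b)).
  rewrite QAB -[X in op_bound _ (X * _)]ger0_norm ?sqr_ge0// -normrN.
  by apply: op_boundZ; exact: op_boundM.
have := norm_mxtrace_le (op_bound_exprB N c1 e0 Qb ABb Db).
rewrite linearB /= => h.
have := mxtrace_expr_mul_le k (trmx_1Z c Ss) (trmx_1Z c Xs); rewrite -Nk -/A -/B => h2.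
have {}h := le_trans (ler_norm _) h.
rewrite -lerBlDl; apply: le_trans (_ : \tr (Q ^+ N) - \tr ((A * B) ^+ N) <= _); first by rewrite lerB.
apply: le_trans h _; rewrite ler_wpM2l//.
have -> : b ^+ 2 * expR (2 * b) / N%:R = N%:R * expR b ^+ 2 * (c ^+ 2 * (b * b)).
  rewrite -expRM_natl /c; field; exact: N0.
rewrite ler_wpM2r ?mulr_ge0 ?sqr_ge0// ler_wpM2l// -exprM mulnC exprM.
rewrite ler_pXn2r ?nnegrE ?expR_ge0 ?exprn_ge0 ?addr_ge0 ?mulr_ge0//.
exact: expr_1Ddiv_le.
Qed.

(** The remainder is factored as [X * Q * X] so that, for symmetric [X], its quadratic form is
    controlled by [nrm (X *m u) ^+ 2]. *)
Lemma expr_1Z_taylor d (X : 'M[R]_d) (c : R) k : op_bound X 1 -> 0 <= c -> k%:R * c <= 1 ->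
  exists2 Q, op_bound Q (2 * k%:R ^+ 2 * c ^+ 2) &
    (1 + c *: X) ^+ k = 1 + (k%:R * c) *: X + X * Q * X.
Proof.
move=> X1 c0; elim: k => [|k IH] kc.
  exists 0; first by rewrite expr0n/= mulr0 mul0r; exact: op_bound0.
  by rewrite mul0r scale0r mulr0 mul0r !addr0.
have [|Q Qb E] := IH; first by apply: le_trans kc; rewrite ler_wpM2r// ler_nat.
exists ((k%:R * c ^+ 2) *: (1 : 'M[R]_d) + (1 + c *: X) * Q).
  have k0 : 0 <= k%:R * c ^+ 2 by rewrite mulr_ge0 ?sqr_ge0.
  have b1 := op_boundZ (k%:R * c ^+ 2) (@op_bound1 d).
  have b2 := op_bound_1Z c0 X1.
  apply: op_boundW (op_boundD b1 (op_boundM _ b2 Qb)) _; first by rewrite addr_ge0// mulr1.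
  rewrite ger0_norm// !mulr1 -natr1 in kc *.
  have : 0 <= k%:R :> R by []. 
  move: (k%:R) k0 kc => z z0 zc zz; rewrite -subr_ge0.
  (* The slack in the recursion for the bound on [Q]; it is nonnegative because
     [(z + 1) * c <= 1]. *)
  have -> : 2 * (z + 1) ^+ 2 * c ^+ 2 - (z * c ^+ 2 + (1 + c) * (2 * z ^+ 2 * c ^+ 2)) =
    c ^+ 2 * (z + 2 + 2 * z * (1 - (z + 1) * c) + 2 * z * c) by ring.
  by rewrite mulr_ge0 ?sqr_ge0// !addr_ge0 ?mulr_ge0 ?subr_ge0.
rewrite exprS E -natr1.
move: (k%:R) => z.
have E1 : c *: X * (1 + (z * c) *: X + X * Q * X) =
    c *: X + (z * c ^+ 2) *: (X * X) + c *: (X * (X * Q * X)).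
  by rewrite !mulrDr mulr1 -!scale_mull -scale_mulr scalerA; congr (_ + _ *: _ + _); ring.
have E2 : X * ((z * c ^+ 2) *: (1 : 'M[R]_d) + (1 + c *: X) * Q) * X =
    (z * c ^+ 2) *: (X * X) + (X * Q * X + c *: (X * (X * Q * X))).
  rewrite mulrDr mulrDl -scale_mulr mulr1 -scale_mull; congr (_ + _).
  by rewrite mulrDl mul1r mulrDr mulrDl -!scale_mull -!scale_mulr -scale_mull !mulrA.
rewrite mulrDl mul1r E1 E2.
move: (X * X) (X * Q * X) (X * (_ * X)) => U V W.
by apply/matrixP => i j; rewrite !mxE; ring.
Qed.

(** Counterpart of [exp X <= 1 + X + 2 X ^ 2] as quadratic forms: for [c = 1 / N] the matrix [Q] of
    the expansion is bounded by 2. *)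
Lemma dot_expr_1Z_le d (X : 'M[R]_d) N u : (0 < N)%N -> op_bound X 1 -> X^T = X ->
  dot u ((1 + N%:R^-1 *: X) ^+ N *m u) <=
    nrm u ^+ 2 + dot u (X *m u) + 2 * nrm (X *m u) ^+ 2.
Proof.
move=> N0 X1 Xs; have n0 : N%:R != 0 :> R by rewrite pnatr_eq0 -lt0n.
have [||Q Qb ->] := expr_1Z_taylor (c := N%:R^-1) (k := N) X1; rewrite ?invr_ge0 ?mulfV//.
rewrite !mulmxDl mul1mx scale1r !dotDr sqr_euclidean_norm lerD2l -!mulmxE -!mulmxA.
rewrite -{1}Xs -dot_mulmx; apply: le_trans (ler_norm _) _.
apply: le_trans (op_bound_dot _ _ Qb) _.
by rewrite -mulrA -expr2 -[X in X * _ <= _]mulrA -exprMn mulfV// expr1n mulr1.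
Qed.

Lemma approx_trexp_ge0 d k (A : 'M[R]_d) : A^T = A -> 0 <= approx_trexp (2 ^ k.+1) A.
Proof.
move=> As; rewrite /approx_trexp; set B := 1 + _.
rewrite expnS mul2n -addnn exprD -{2}(trmx_1Z _ As : B^T = B) -trmxX mxtrace_mul_trmx.
by rewrite sumr_ge0 // => p _; exact: sqr_ge0.
Qed.

(* The analogue of [E (tr (exp (S + X))) <= |E (exp X)| * tr (exp S)]. *)
Lemma approx_trexp_mean_le d k (G : finType) (p : G -> R) (X : G -> 'M[R]_d)
    (S : 'M[R]_d) b eta v :
  (forall a, 0 <= p a) -> \sum_a p a = 1 -> 1 <= b ->
  op_bound S b -> S^T = S -> (forall a, op_bound (X a) 1) -> (forall a, (X a)^T = X a) ->
  (forall u, \sum_a p a * dot u (X a *m u) <= eta * nrm u ^+ 2) ->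
  (forall u, \sum_a p a * nrm (X a *m u) ^+ 2 <= v * nrm u ^+ 2) ->
  \sum_a p a * approx_trexp (2 ^ k.+1) (S + X a) <=
    (1 + eta + 2 * v) * approx_trexp (2 ^ k.+1) S
    + d%:R * (b ^+ 2 * expR (2 * b) / (2 ^ k.+1)%:R).
Proof.
move=> p0 p1 b1 Sb Ss X1 Xs Xm Xv; have b0 : 0 <= b := le_trans ler01 b1.
set N := (2 ^ k.+1)%N; set e := d%:R * _.
set A := 1 + N%:R^-1 *: S; set B := fun a => 1 + N%:R^-1 *: X a.
apply: (@le_trans _ _ (\sum_a p a * (\tr (A ^+ N * B a ^+ N) + e))).
  apply: ler_sum => a _; rewrite ler_wpM2l//.
  by apply: approx_trexpD_le => //; apply: op_boundW (X1 a) _.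
under eq_bigr do rewrite mulrDr -mxtraceZ scale_mulr.
rewrite big_split /= -mulr_suml p1 mul1r lerD2r -(raddf_sum (@mxtrace R d)) -mulr_sumr.
rewrite /approx_trexp -/A.
(* Two equal symmetric factors, the form required by [mxtrace_sandwich_le]. *)
have -> : A ^+ N = A ^+ (2 ^ k) * A ^+ (2 ^ k) by rewrite -exprD addnn -mul2n -expnS.
apply: mxtrace_sandwich_le => [|u]; first by rewrite trmxX trmx_1Z.
rewrite mulmx_suml dot_sumr.
under eq_bigr do rewrite -scalemxAl dotZr.
apply: (@le_trans _ _ (\sum_a p a * (nrm u ^+ 2 + dot u (X a *m u) + 2 * nrm (X a *m u) ^+ 2))).
  by apply: ler_sum => a _; rewrite ler_wpM2l// dot_expr_1Z_le// expn_gt0.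
under eq_bigr do rewrite !mulrDr (mulrCA _ 2).
rewrite !big_split /= -mulr_suml p1 -mulr_sumr !mulrDl.
by rewrite -mulrA lerD ?lerD ?ler_wpM2l.
Qed.

(** * Hermitian dilation *)

Section dilation.
Context {d1 d2 : nat}.
Implicit Types A : 'M[R]_(d1, d2).

Definition dilation A : 'M[R]_(d1 + d2) := block_mx 0 A A^T 0.

Lemma trmx_dilation A : (dilation A)^T = dilation A.
Proof. by rewrite tr_block_mx !trmx0 trmxK. Qed.

Lemma dilationD A B : dilation (A + B) = dilation A + dilation B.
Proof. by rewrite /dilation add_block_mx !addr0 linearD. Qed.

Lemma dilationN A : dilation (- A) = - dilation A.
Proof. by rewrite /dilation opp_block_mx !oppr0 linearN. Qed.

Lemma dilation0 : dilation 0 = 0.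
Proof. by rewrite /dilation trmx0 block_mx0. Qed.

Lemma dot_dilation A x y :
  dot (col_mx x y) (dilation A *m col_mx x y) = 2 * dot x (A *m y).
Proof.
rewrite mul_block_col !mul0mx add0r addr0 dot_col_mx.
by rewrite -dot_mulmx dotC; ring.
Qed.

Lemma sqr_norm_dilation A x y :
  nrm (dilation A *m col_mx x y) ^+ 2 = nrm (A *m y) ^+ 2 + nrm (A^T *m x) ^+ 2.
Proof.
by rewrite mul_block_col !mul0mx add0r addr0 sqr_euclidean_norm dot_col_mx -!sqr_euclidean_norm.
Qed.

Lemma sqr_norm_col_mx (x : 'cV[R]_d1) (y : 'cV[R]_d2) :
  nrm (col_mx x y) ^+ 2 = nrm x ^+ 2 + nrm y ^+ 2.
Proof. by rewrite !sqr_euclidean_norm dot_col_mx. Qed.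

Lemma op_bound_dilation A c : 0 <= c -> op_bound A c -> op_bound (dilation A) c.
Proof.
move=> c0 Ac u; rewrite -[u]vsubmxK.
rewrite -(@ler_pXn2r _ 2) ?nnegrE ?mulr_ge0// exprMn sqr_norm_dilation sqr_norm_col_mx.
have h1 := Ac (dsubmx u); have h2 := op_boundT c0 Ac (usubmx u).
by rewrite mulrDr addrC -!exprMn lerD// ler_pXn2r ?nnegrE ?mulr_ge0.
Qed.

(** The two halves of [u] are proportional to [A *m y] and [y], for [y] in the unit ball with
    [x < nrm (A *m y)]. The quadratic form there is [nrm (A *m y) / nrm y], and [nrm y <= 1]. *)
Lemma spectral_norm_gt_dilation A x : 0 <= x -> x < sn A ->
  exists2 u, nrm u = 1 & x < dot u (dilation A *m u).
Proof.
move=> x0 /spectral_norm_gt[y y1 xy].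
have Ay0 : 0 < nrm (A *m y) := le_lt_trans x0 xy.
have y0 : 0 < nrm y.
  rewrite lt_neqAle euclidean_norm_ge0 andbT; apply/eqP => y0.
  by move: Ay0; rewrite (euclidean_norm_eq0 (esym y0)) mulmx0 euclidean_norm0 ltxx.
pose z := (nrm (A *m y))^-1 *: (A *m y); pose y' := (nrm y)^-1 *: y.
have z1 : nrm z = 1 by rewrite euclidean_normZ ger0_norm ?invr_ge0 ?ltW// mulVf ?gt_eqF.
have y'1 : nrm y' = 1 by rewrite euclidean_normZ ger0_norm ?invr_ge0 ?ltW// mulVf ?gt_eqF.
have s2 : Num.sqrt (2^-1 : R) ^+ 2 = 2^-1 by rewrite sqr_sqrtr// invr_ge0.
exists (Num.sqrt 2^-1 *: col_mx z y').
  apply/eqP; rewrite -(@eqrXn2 _ 2)// expr1n euclidean_normZ exprMn real_normK ?num_real//.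
  by rewrite s2 sqr_norm_col_mx z1 y'1 expr1n -mulr2n -mulr_natr mulVf.
rewrite -scalemxAr dotZr dotZl dot_dilation mulrA -expr2 s2 mulrA mulVf// mul1r.
rewrite /z /y' dotZl -scalemxAr dotZr -sqr_euclidean_norm.
apply: lt_le_trans xy _; rewrite expr2 mulrCA mulKf ?gt_eqF//.
by rewrite ler_pMl// invf_ge1.
Qed.

End dilation.

End euclidean.

(** * Sums of independent random matrices *)

Section chain.
Context {R : realType} {V : zmodType} {G : finType}.
Variables (p : nat -> G -> R) (M : nat -> G -> V).
Hypothesis p_ge0 : forall k a, 0 <= p k a.
Hypothesis p_sum1 : forall k, \sum_a p k a = 1.

(* [chain_mean k f] is the expectation of [f (M 0 a_0 + ... + M k.-1 a_(k.-1))]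
   for independent [a_j] with laws [p j]. *)
Definition chain_step k (f : V -> R) (S : V) : R := \sum_a p k a * f (S + M k a).

Fixpoint chain_mean k (f : V -> R) : R :=
  if k is j.+1 then chain_mean j (chain_step j f) else f 0.

(** [Q k] is an invariant of the sums of [k] terms, so that [f] and [g] are compared only on sums
    that can occur. *)
Lemma chain_mean_le (Q : nat -> V -> Prop) K f g : Q 0%N 0 ->
  (forall k S a, (k < K)%N -> Q k S -> Q k.+1 (S + M k a)) ->
  (forall S, Q K S -> f S <= g S) -> chain_mean K f <= chain_mean K g.
Proof.
move=> Q0; elim: K f g => [|K IH] f g Qs fg /=; first exact: fg.
apply: IH => [k S a kK|S QS]; first by apply: Qs; exact: ltnW.
by apply: ler_sum => a _; rewrite ler_wpM2l//; apply: fg; exact: Qs.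
Qed.

Lemma chain_mean_affine K f c e :
  chain_mean K (fun S => c * f S + e) = c * chain_mean K f + e.
Proof.
elim: K f => [//|K IH] f /=; rewrite -IH; congr chain_mean; apply/funext => S.
rewrite /chain_step; under eq_bigr do rewrite mulrDr mulrCA.
by rewrite big_split /= -mulr_sumr -mulr_suml p_sum1 mul1r.
Qed.

End chain.

Section chain_tail.
Context {R : realType} {d1 d2 : nat} {G : finType}.
Variables (p : nat -> G -> R) (M : nat -> G -> 'M[R]_(d1, d2)).
Hypothesis p_ge0 : forall k a, 0 <= p k a.
Hypothesis p_sum1 : forall k, \sum_a p k a = 1.
Variables (K : nat) (L theta eta v : R).
Hypothesis L_ge0 : 0 <= L.
Hypothesis theta_ge0 : 0 <= theta.
Hypothesis theta_L : theta * L <= 1.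
Hypothesis eta_ge0 : 0 <= eta.
Hypothesis v_ge0 : 0 <= v.
Hypothesis M_bound : forall k a, op_bound (M k a) L.
Hypothesis M_mean : forall k u, (k < K)%N ->
  \sum_a p k a * dot u (dilation (M k a) *m u) <= eta * euclidean_norm u ^+ 2.
Hypothesis M_var : forall k u, (k < K)%N ->
  \sum_a p k a * euclidean_norm (dilation (M k a) *m u) ^+ 2 <= v * euclidean_norm u ^+ 2.

(** [b] bounds the scaled dilations of the partial sums, and the [+ 1] ensures [1 <= b]; [lam] is
    the factor that each summand contributes to the Laplace transform. *)
Let b : R := K%:R + 1.
Let lam : R := 1 + theta * eta + 2 * (theta ^+ 2 * v).
Let d : R := (d1 + d2)%:R.

Let op_bound_scaled_dilation j (S : 'M[R]_(d1, d2)) : op_bound S (j%:R * L) ->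
  op_bound (theta *: dilation S) j%:R.
Proof.
move=> SL; apply: op_boundW (op_boundZ _ (op_bound_dilation _ SL)) _.
  by rewrite mulr_ge0.
by rewrite ger0_norm// mulrCA -[leRHS]mulr1 ler_wpM2l.
Qed.

(** One use of [approx_trexp_mean_le] per summand, under the invariant that sums of [j] terms are
    bounded by [j * L]. As [lam >= 1], every additive error may be charged the full factor
    [lam ^+ j]. *)
Lemma chain_approx_trexp_le N k j : N = (2 ^ k.+1)%N -> (j <= K)%N ->
  chain_mean p M j (fun S => approx_trexp N (theta *: dilation S)) <=
    lam ^+ j * (d + j%:R * (d * (b ^+ 2 * expR (2 * b) / N%:R))).
Proof.
move=> Nk; have lam1 : 1 <= lam by rewrite /lam -addrA lerDl addr_ge0 ?mulr_ge0 ?sqr_ge0.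
set e := d * _.
have e0 : 0 <= e.
  by rewrite mulr_ge0 ?ler0n// divr_ge0// mulr_ge0 ?sqr_ge0 ?expR_ge0.
elim: j => [_|j IH jK] /=.
  by rewrite /approx_trexp dilation0 !scaler0 addr0 expr1n mxtrace1 expr0 mul1r mul0r addr0.
apply: (@le_trans _ _ (lam * chain_mean p M j (fun S => approx_trexp N (theta *: dilation S)) + e)).
  rewrite -chain_mean_affine//.
  apply: (chain_mean_le p_ge0 (Q := fun j S => op_bound S (j%:R * L))) => [|i S a ij SL|S SL].
  - by rewrite mul0r; exact: op_bound0.
  - by rewrite -natr1 mulrDl mul1r; exact: op_boundD.
  rewrite /chain_step; under eq_bigr do rewrite dilationD scalerDr.
  rewrite /e Nk; apply: (approx_trexp_mean_le k (eta := theta * eta) (v := theta ^+ 2 * v)) => //.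
  - by rewrite lerDr.
  - apply: op_boundW (op_bound_scaled_dilation SL) _.
    by rewrite -[leLHS]addr0 lerD// ler_nat ltnW.
  - by rewrite linearZ /= trmx_dilation.
  - by move=> a; apply: (@op_bound_scaled_dilation 1%N); rewrite mul1r.
  - by move=> a; rewrite linearZ /= trmx_dilation.
  - move=> u; under eq_bigr do rewrite -scalemxAl dotZr mulrCA.
    by rewrite -mulr_sumr -mulrA ler_wpM2l// M_mean.
  - move=> u; under eq_bigr do rewrite -scalemxAl euclidean_normZ exprMn real_normK ?num_real// mulrCA.
    by rewrite -mulr_sumr -mulrA ler_wpM2l ?sqr_ge0// M_var.
have {}IH := IH (ltnW jK).
apply: (@le_trans _ _ (lam ^+ j.+1 * (d + j%:R * e) + lam ^+ j.+1 * e)).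
  rewrite lerD//; first by rewrite exprS -mulrA ler_wpM2l// (le_trans ler01).
  by rewrite -[leLHS]mul1r ler_wpM2r// exprn_ege1.
by rewrite -natr1; lra.
Qed.

(** The pointwise form of Markov's inequality. On the event, the dilation has a quadratic form above
    [x] at some unit vector; off the event, the trace is nonnegative. *)
Lemma approx_trexp_ge_indicator N k x (S : 'M[R]_(d1, d2)) :
  N = (2 ^ k.+1)%N -> 0 <= x ->
  (1 + N%:R^-1 * (theta * x)) ^+ N * (x < spectral_norm S)%R%:R
     <= approx_trexp N (theta *: dilation S).
Proof.
move=> Nk x0; have s : (theta *: dilation S)^T = theta *: dilation S.
  by rewrite linearZ /= trmx_dilation.
have c0 : 0 <= (N%:R^-1 : R) by rewrite invr_ge0.
case: ltP => xS; last by rewrite mulr0 Nk approx_trexp_ge0.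
have [u u1 xu] := spectral_norm_gt_dilation x0 xS.
have h : 1 + N%:R^-1 * (theta * x) <=
    dot u ((1 + N%:R^-1 *: (theta *: dilation S)) *m u).
  rewrite mulmxDl mul1mx dotDr -sqr_euclidean_norm u1 expr1n lerD2l.
  by rewrite -!scalemxAl !dotZr ler_wpM2l// ler_wpM2l// ltW.
have h0 : 0 <= 1 + N%:R^-1 * (theta * x) by rewrite addr_ge0 ?mulr_ge0.
have := mxtrace_expr_ge k (trmx_1Z N%:R^-1 s) u1 (le_trans h0 h).
rewrite mulr1 -Nk; apply: le_trans.
apply: lerXn2r => //; rewrite nnegrE; exact: le_trans h0 h.
Qed.

(** For [z = y / N], [1 + z >= exp (z / (1 + z))] and [z / (1 + z) >= z - z ^ 2]. *)
Lemma expr_1Ddiv_ge (y : R) N : (0 < N)%N -> 0 <= y ->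
  expR (y - y ^+ 2 / N%:R) <= (1 + N%:R^-1 * y) ^+ N.
Proof.
move=> N0 y0; set z := N%:R^-1 * y.
have z0 : 0 <= z by rewrite mulr_ge0 ?invr_ge0.
have n0 : N%:R != 0 :> R by rewrite pnatr_eq0 -lt0n.
have h : expR (z / (1 + z)) <= 1 + z.
  have := expR_ge1Dx (- (z / (1 + z))); rewrite expRN.
  have -> : 1 - z / (1 + z) = (1 + z)^-1 by field; rewrite gt_eqF// ltr_pwDl.
  by rewrite lef_pV2// posrE ?expR_gt0// ltr_pwDl.
apply: le_trans (_ : expR (z / (1 + z)) ^+ N <= _); last first.
  by rewrite ler_pXn2r ?nnegrE ?expR_ge0 ?addr_ge0.
rewrite -expRM_natl ler_expR.
have -> : y - y ^+ 2 / N%:R = N%:R * (z - z ^+ 2) by rewrite /z; field.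
rewrite ler_wpM2l// ler_pdivlMr ?ltr_pwDl//.
have -> : (z - z ^+ 2) * (1 + z) = z - z ^+ 3 by ring.
by rewrite gerBl exprn_ge0.
Qed.

(** Markov's inequality for the Laplace transform; [kappa] pays for keeping [N] finite. *)
Lemma chain_tail x kappa : 0 <= x -> 0 < kappa ->
  chain_mean p M K (fun S => (x < spectral_norm S)%R%:R) <=
    d * expR (- (theta * x) + K%:R * (theta * eta + 2 * (theta ^+ 2 * v)) + kappa).
Proof.
move=> x0 kappa0; set f := fun _ => _.
(* [C / N] is the total loss in the exponent: the first term comes from the additive errors of
   [chain_approx_trexp_le], the second from [expr_1Ddiv_ge]. *)
pose C := K%:R * (b ^+ 2 * expR (2 * b)) + (theta * x) ^+ 2.
have b0 : 0 <= b by rewrite addr_ge0.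
have C0 : 0 <= C by rewrite addr_ge0 ?sqr_ge0 ?mulr_ge0 ?expR_ge0 ?exprn_ge0.
have [k Ck] : exists k, C / (2 ^ k.+1)%:R <= kappa.
  exists (Num.bound (C / kappa)); rewrite ler_pdivrMr ?ltr0n ?expn_gt0//.
  rewrite mulrC -ler_pdivrMr//; apply: le_trans (ltW (archi_boundP _)) _.
    by rewrite divr_ge0// ltW.
  by rewrite ler_nat (leq_trans (ltnW (ltn_expl _ (leqnn 2))))// leq_exp2l.
set N := (2 ^ k.+1)%N in Ck.
have N0 : (0 < N)%N by rewrite expn_gt0.
have tx0 : 0 <= theta * x by rewrite mulr_ge0.
have h1 := chain_approx_trexp_le (erefl N) (leqnn K).
have h2 : (1 + N%:R^-1 * (theta * x)) ^+ N * chain_mean p M K f <=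
    chain_mean p M K (fun S => approx_trexp N (theta *: dilation S)).
  rewrite -[leLHS]addr0 -chain_mean_affine//.
  apply: (chain_mean_le p_ge0 (Q := fun _ _ => True)) => // S _.
  by rewrite addr0; exact: (approx_trexp_ge_indicator _ (erefl N)).
have h3 := expr_1Ddiv_ge N0 tx0.
have f0 : 0 <= chain_mean p M K f.
  have := chain_mean_affine M p_sum1 K (fun=> 0) 0 0; rewrite !mul0r !addr0 => <-.
  by apply: (chain_mean_le p_ge0 (Q := fun _ _ => True)) => // S _; rewrite /f ler0n.
have lam0 : 0 <= lam.
  by rewrite /lam !addr_ge0// ?(mulr_ge0 theta_ge0)// mulr_ge0// mulr_ge0// sqr_ge0.
have h4 : lam ^+ K <= expR (K%:R * (theta * eta + 2 * (theta ^+ 2 * v))).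
  rewrite expRM_natl; apply: lerXn2r; rewrite ?nnegrE ?expR_ge0//.
  by rewrite /lam -addrA expR_ge1Dx.
have h5 : d + K%:R * (d * (b ^+ 2 * expR (2 * b) / N%:R)) <=
    d * expR (K%:R * (b ^+ 2 * expR (2 * b)) / N%:R).
  rewrite mulrCA -{1}[d]mulr1 -mulrDr ler_wpM2l//.
  by rewrite !mulrA; apply: expR_ge1Dx.
have {h2}h : expR (theta * x - (theta * x) ^+ 2 / N%:R) * chain_mean p M K f <=
   expR (K%:R * (theta * eta + 2 * (theta ^+ 2 * v))) *
   (d * expR (K%:R * (b ^+ 2 * expR (2 * b)) / N%:R)).
  apply: le_trans (ler_wpM2r f0 h3) _; apply: le_trans h2 _; apply: le_trans h1 _.
  apply: ler_pM; rewrite ?exprn_ge0//.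
  by rewrite addr_ge0 ?ler0n// mulr_ge0// mulr_ge0 ?ler0n// divr_ge0// mulr_ge0 ?expR_ge0 ?exprn_ge0.
rewrite mulrC -ler_pdivlMr ?expR_gt0// -expRN in h.
apply: le_trans h _.
rewrite [X in X * _]mulrCA -(mulrA d) -!expRD.
rewrite ler_wpM2l ?ler0n// ler_expR.
move: Ck; rewrite /C mulrDl; set A := K%:R * _ / _; set B := (_ ^+ 2) / _; lra.
Qed.

End chain_tail.

(** * Decoupling by beta-mixing *)

Section bounded_expectation.
Context d (T : measurableType d) (R : realType) (P : probability T R).

Definition bounded_mfun (f : T -> R) : Prop :=
  measurable_fun [set: T] f /\ exists c, forall w, `|f w| <= c.

Definition expect (f : T -> R) : R := fine 'E_P[f]%E.

Definition prob (A : set T) : R := fine (P A).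

Lemma probE A : measurable A -> P A = (prob A)%:E.
Proof. by move=> mA; rewrite /prob fineK// fin_num_measure. Qed.

Lemma prob_ge0 A : 0 <= prob A.
Proof. by rewrite /prob fine_ge0. Qed.

Lemma expectE f : expect f = \int[P]_w f w.
Proof. by rewrite /expect unlock. Qed.

Lemma bounded_mfun_integrable f : bounded_mfun f -> P.-integrable [set: T] (EFin \o f).
Proof.
move=> [mf [c fc]]; apply: measurable_bounded_integrable => //.
  by rewrite /= probability_setT ltry.
by exists c; split; [exact: num_real|move=> y cy w _; exact: le_trans (fc w) (ltW cy)].
Qed.

Lemma bounded_mfun_cst c : bounded_mfun (fun=> c).
Proof. by split; [exact: measurable_cst|exists `|c|]. Qed.

Lemma bounded_mfunD f g : bounded_mfun f -> bounded_mfun g -> bounded_mfun (fun w => f w + g w).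
Proof.
move=> [mf [a fa]] [mg [b gb]]; split; first exact: measurable_funD.
by exists (a + b) => w; apply: le_trans (ler_normD _ _) _; rewrite lerD.
Qed.

Lemma bounded_mfunM f g : bounded_mfun f -> bounded_mfun g -> bounded_mfun (fun w => f w * g w).
Proof.
move=> [mf [a fa]] [mg [b gb]]; split; first exact: measurable_funM.
by exists (a * b) => w; rewrite normrM ler_pM.
Qed.

Lemma bounded_mfunZ c f : bounded_mfun f -> bounded_mfun (fun w => c * f w).
Proof. by move=> bf; apply: bounded_mfunM => //; exact: bounded_mfun_cst. Qed.

Lemma bounded_mfun_sum (I : Type) (r : seq I) (f : I -> T -> R) :
  (forall i, bounded_mfun (f i)) -> bounded_mfun (fun w => \sum_(i <- r) f i w).
Proof.
move=> bf; elim: r => [|i r IH].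
  by under eq_fun do rewrite big_nil; exact: bounded_mfun_cst.
by under eq_fun do rewrite big_cons; exact: bounded_mfunD.
Qed.

Lemma expect_cst c : expect (fun=> c) = c.
Proof. by rewrite expectE Rintegral_cst//= probability_setT mulr1. Qed.

Lemma expectD f g : bounded_mfun f -> bounded_mfun g ->
  expect (fun w => f w + g w) = expect f + expect g.
Proof. by move=> bf bg; rewrite !expectE RintegralD//; exact: bounded_mfun_integrable. Qed.

Lemma expectZ c f : bounded_mfun f -> expect (fun w => c * f w) = c * expect f.
Proof. by move=> bf; rewrite !expectE RintegralZl//; exact: bounded_mfun_integrable. Qed.

Lemma expect_sum (I : Type) (r : seq I) (f : I -> T -> R) :
  (forall i, bounded_mfun (f i)) ->
  expect (fun w => \sum_(i <- r) f i w) = \sum_(i <- r) expect (f i).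
Proof.
move=> bf; elim: r => [|i r IH].
  by under eq_fun do rewrite big_nil; rewrite big_nil expect_cst.
under eq_fun do rewrite big_cons.
by rewrite expectD// ?IH ?big_cons//; exact: bounded_mfun_sum.
Qed.

Lemma expect_le f g : bounded_mfun f -> bounded_mfun g ->
  (forall w, f w <= g w) -> expect f <= expect g.
Proof. by move=> bf bg fg; rewrite !expectE le_Rintegral//; exact: bounded_mfun_integrable. Qed.

Lemma bounded_mfun_indic A : measurable A -> bounded_mfun (\1_A : T -> R).
Proof.
move=> mA; split; first exact: measurable_indic.
by exists 1 => w; rewrite indicE; case: (_ \in _); rewrite ?normr0 ?normr1.
Qed.

Lemma expect_indic A : measurable A -> expect (\1_A : T -> R) = prob A.
Proof. by move=> mA; rewrite /expect expectation_indic. Qed.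

Section finite_valued.
Context {G : finType} (A : T -> G).
Hypothesis mA : forall a, measurable (A @^-1` [set a]).

Lemma finite_valued_decomp (f : G -> R) :
  (fun w => f (A w)) = (fun w => \sum_a f a * \1_(A @^-1` [set a]) w).
Proof.
apply/funext => w; rewrite (bigD1 (A w))//= big1 ?addr0 => [|a aw].
  by rewrite indicE mem_set// mulr1.
by rewrite indicE memNset ?mulr0// => /= wa; rewrite wa eqxx in aw.
Qed.

Lemma bounded_mfun_finite_valued (f : G -> R) : bounded_mfun (fun w => f (A w)).
Proof.
rewrite finite_valued_decomp; apply: bounded_mfun_sum => a.
by apply: bounded_mfunZ; exact: bounded_mfun_indic.
Qed.

Lemma expect_finite_valued (f : G -> R) :
  expect (fun w => f (A w)) = \sum_a prob (A @^-1` [set a]) * f a.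
Proof.
rewrite finite_valued_decomp expect_sum => [|a].
  apply: eq_bigr => a _; rewrite expectZ; last exact: bounded_mfun_indic.
  by rewrite expect_indic// mulrC.
by apply: bounded_mfunZ; exact: bounded_mfun_indic.
Qed.

Lemma sum_prob_finite_valued : \sum_a prob (A @^-1` [set a]) = 1.
Proof.
by rewrite -(expect_cst 1) (expect_finite_valued (fun=> 1)); under [RHS]eq_bigr do rewrite mulr1.
Qed.

End finite_valued.

Section decoupling.
Context {GA GB : finType} (A : T -> GA) (B : T -> GB) (FA FB : set (set T)).
Hypothesis FA_meas : FA `<=` measurable.
Hypothesis FB_meas : FB `<=` measurable.
Hypothesis A_FA : forall a, FA (A @^-1` [set a]).
Hypothesis B_FB : forall b, FB (B @^-1` [set b]).
Variable beta : R.
Hypothesis beta_ge : (beta_dep P FA FB <= beta%:E)%E.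

Let mA a : measurable (A @^-1` [set a]). Proof. exact: FA_meas. Qed.
Let mB b : measurable (B @^-1` [set b]). Proof. exact: FB_meas. Qed.

Let excess a b : R := prob (A @^-1` [set a] `&` B @^-1` [set b]) -
  prob (A @^-1` [set a]) * prob (B @^-1` [set b]).

(* The partitions in [beta_dep] consist of nonempty cells, hence the restriction
   to the values that are attained. *)
Lemma partition_attained (G : finType) (Y : T -> G) :
  let S := [set a | `[< Y @^-1` [set a] !=set0 >]]%SET in
  partition [set: 'I_#|S|] (fun i => Y @^-1` [set enum_val i]) [set: T].
Proof.
move=> S; split.
- apply/seteqP; split => // w _.
  have YS : Y w \in S by rewrite inE; apply/asboolP; exists w.
  by exists (enum_rank_in YS (Y w)) => //=; rewrite enum_rankK_in.
- apply/trivIsetP => i j _ _ ij; apply/seteqP; split => // w [/= wi wj].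
  by case/eqP: ij; apply: enum_val_inj; rewrite -wi -wj.
- by move=> i _; have := enum_valP i; rewrite inE => /asboolP.
Qed.

(** Values that are not attained contribute zero, and the others index partitions admissible in the
    supremum. The factor 2 undoes the [2^-1] of [beta_dep]. *)
Lemma sum_excess_le : \sum_a \sum_b `|excess a b| <= 2 * beta.
Proof.
set SA := [set a | `[< A @^-1` [set a] !=set0 >]]%SET.
set SB := [set b | `[< B @^-1` [set b] !=set0 >]]%SET.
have -> : \sum_a \sum_b `|excess a b| =
    \sum_(i < #|SA|) \sum_(j < #|SB|) `|excess (enum_val i) (enum_val j)|.
  rewrite -(big_enum_val (fun a => \sum_(j < #|SB|) `|excess a (enum_val j)|)).
  rewrite [RHS]big_mkcond /=; apply: eq_bigr => a _.
  rewrite -(big_enum_val (fun b => `|excess a b|)) [X in if _ then X else _]big_mkcond /=.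
  have P0 : prob set0 = 0 by rewrite /prob measure0.
  case: ifPn => [aS|].
    apply: eq_bigr => b _; case: ifPn => //; rewrite inE => /asboolPn /set0P/negP.
    by rewrite negbK => /eqP b0; rewrite /excess b0 setI0 P0 mulr0 subrr normr0.
  rewrite inE => /asboolPn /set0P/negP; rewrite negbK => /eqP a0.
  by rewrite big1// => b _; rewrite /excess a0 set0I P0 mul0r subrr normr0.
have := beta_ge; rewrite /beta_dep.
set x := (\sum_(i < #|SA|) _)%R; set V := [set _ | _].
have Vx : V x%:E.
  exists #|SA|, #|SB|, (fun i => A @^-1` [set enum_val i]), (fun i => B @^-1` [set enum_val i]).
  split => //; [exact: partition_attained|exact: partition_attained|].
  rewrite /x -sumEFin; apply: eq_bigr => i _; rewrite -sumEFin; apply: eq_bigr => j _.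
  by rewrite !probE//; exact: measurableI.
move=> h; have : ((2^-1 * x)%:E <= beta%:E)%E.
  apply: le_trans h; rewrite EFinM lee_pmul2l ?lte_fin ?invr_gt0//.
  exact: ereal_sup_ubound.
by rewrite lee_fin mulrC ler_pdivrMr// mulrC.
Qed.

(** The signed weights [excess] sum to zero, so [F] can be centred at [2^-1]. The centred function
    is at most [2^-1] in absolute value, so the total weight [2 * beta] costs only [beta]. *)
Lemma decoupling (F : GA -> GB -> R) : (forall a b, 0 <= F a b <= 1) ->
  expect (fun w => F (A w) (B w)) <=
    expect (fun w => \sum_b prob (B @^-1` [set b]) * F (A w) b) + beta.
Proof.
move=> F01.
have pairE p : (fun w => (A w, B w)) @^-1` [set p] = A @^-1` [set p.1] `&` B @^-1` [set p.2].
  by case: p => a b; apply/seteqP; split => w /= [-> ->].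
have mAB p : measurable ((fun w => (A w, B w)) @^-1` [set p]).
  by rewrite pairE; exact: measurableI.
have excessE : \sum_a \sum_b prob (A @^-1` [set a] `&` B @^-1` [set b]) = 1.
  rewrite -(sum_prob_finite_valued mAB) pair_bigA /=; apply: eq_bigr => p _.
  by rewrite pairE.
have sum0 : \sum_a \sum_b excess a b = 0.
  rewrite /excess; under eq_bigr do rewrite sumrB -mulr_sumr sum_prob_finite_valued// mulr1.
  by rewrite sumrB excessE sum_prob_finite_valued// subrr.
rewrite (expect_finite_valued mAB (fun p => F p.1 p.2)).
rewrite (expect_finite_valued mA (fun a => \sum_b prob (B @^-1` [set b]) * F a b)).
rewrite -lerBlDl.
have -> : \sum_a prob ((fun w => (A w, B w)) @^-1` [set a]) * F a.1 a.2 -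
    \sum_a prob (A @^-1` [set a]) * (\sum_b prob (B @^-1` [set b]) * F a b) =
    \sum_a \sum_b excess a b * (F a b - 2^-1).
  have -> : \sum_a \sum_b excess a b * (F a b - 2^-1) = \sum_a \sum_b excess a b * F a b.
    under eq_bigr do under eq_bigr do rewrite mulrBr.
    under eq_bigr do rewrite sumrB -mulr_suml.
    by rewrite sumrB -mulr_suml sum0 mul0r subr0.
  rewrite /excess; under [RHS]eq_bigr do (under eq_bigr do rewrite mulrBl; rewrite sumrB).
  rewrite sumrB; congr (_ - _).
    by rewrite pair_bigA /=; apply: eq_bigr => p _; rewrite pairE.
  by apply: eq_bigr => a _; rewrite mulr_sumr; apply: eq_bigr => b _; rewrite mulrA.
apply: le_trans (_ : \sum_a \sum_b `|excess a b| * 2^-1 <= _).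
  apply: ler_sum => a _; apply: ler_sum => b _.
  apply: le_trans (ler_norm _) _; rewrite normrM ler_wpM2l// ler_norml.
  by have /andP[? ?] := F01 a b; apply/andP; split; lra.
under eq_bigr do rewrite -mulr_suml.
by rewrite -mulr_suml ler_pdivrMr// mulrC; exact: sum_excess_le.
Qed.

End decoupling.

End bounded_expectation.

(** * Replacing a whole sequence by independent variables *)

Section chain_decoupling.
Context d (T : measurableType d) (R : realType) (P : probability T R).
Context {V : zmodType} {G : finType}.
Variables (Y : nat -> T -> G) (M : nat -> G -> V) (FA FB : nat -> set (set T)).
Hypothesis FA_meas : forall k, FA k `<=` measurable.
Hypothesis FB_meas : forall k, FB k `<=` measurable.
Hypothesis past_FA : forall k (h : {ffun 'I_k -> G}),
  FA k ((fun w => [ffun j : 'I_k => Y j w]) @^-1` [set h]).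
Hypothesis Y_FB : forall k a, FB k (Y k @^-1` [set a]).
Variable beta : R.
Hypothesis beta_ge : forall k, (beta_dep P (FA k) (FB k) <= beta%:E)%E.

(** Induction from the last variable: [decoupling] separates [Y k] from its past at the cost of one
    [beta], and averaging over [Y k] turns [f] into [chain_step], a function of the shorter sum. *)
Lemma expect_sum_le_chain_mean k (f : V -> R) : (forall S, 0 <= f S <= 1) ->
  expect P (fun w => f (\sum_(j < k) M j (Y j w))) <=
    chain_mean (fun j a => prob P (Y j @^-1` [set a])) M k f + k%:R * beta.
Proof.
elim: k f => [|k IH] f f01.
  by under eq_fun do rewrite big_ord0; rewrite expect_cst mul0r addr0.
pose F (h : {ffun 'I_k -> G}) b := f (\sum_(j < k) M j (h j) + M k b).
have E w : f (\sum_(j < k.+1) M j (Y j w)) = F [ffun j : 'I_k => Y j w] (Y k w).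
  rewrite /F big_ord_recr /=; congr (f (_ + _)).
  by apply: eq_bigr => j _; rewrite ffunE.
have mY b : measurable (Y k @^-1` [set b]) by apply: (@FB_meas k); exact: Y_FB.
under eq_fun do rewrite E.
apply: le_trans (decoupling (@FA_meas k) (@FB_meas k) (@past_FA k) (@Y_FB k) (beta_ge k) _) _.
  by move=> h b; exact: f01.
rewrite -natr1 mulrDl mul1r addrA lerD2r /=.
apply: le_trans (IH _ _) => [|S].
  rewrite le_eqVlt; apply/orP; left; apply/eqP; congr expect; apply/funext => w.
  rewrite /chain_step /F; apply: eq_bigr => b _; congr (_ * f (_ + _)).
  by apply: eq_bigr => j _; rewrite ffunE.
(* The averaged function still has values in [[0, 1]], because the weights sum to 1. *)
apply/andP; split.
  by apply: sumr_ge0 => a _; rewrite mulr_ge0 ?prob_ge0//; have /andP[] := f01 (S + M k a).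
rewrite -(sum_prob_finite_valued P mY); apply: ler_sum => a _.
by rewrite -[leRHS]mulr1 ler_wpM2l ?prob_ge0//; have /andP[] := f01 (S + M k a).
Qed.

End chain_decoupling.

(** * Finite-dimensional events of the process *)

Section sigma_process.
Context d (T : measurableType d) dU (U : measurableType dU) (X : int -> {mfun T >-> U}).

Lemma sigma_process_measurable K : sigma_process X K `<=` measurable.
Proof.
apply: smallest_sub; first exact: sigma_algebra_measurable.
move=> _ [k Kk [B mB <-]]; exact: (measurable_funPT (X k) measurableT).
Qed.

Lemma sigma_process_bigcap (K : set int) (I : finType) (s : I -> int) (B : I -> set U) :
  (forall i, K (s i)) -> (forall i, measurable (B i)) ->
  sigma_process X K (\bigcap_i X (s i) @^-1` B i).
Proof.
move=> Ks mB.
pose C := \bigcup_(k in K) preimage_set_system [set: T] (X k) measurable.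
have := @fin_bigcap_measurable _ (g_sigma_algebraType C) I [set: I] (fun i => X (s i) @^-1` B i).
apply; first exact: finite_finset.
move=> i _; apply: sub_gen_smallest; exists (s i); first exact: Ks.
by exists (B i) => //; rewrite setTI.
Qed.

End sigma_process.

(** * Measurability of the spectral norm *)

Section measurable_matrices.
Context d (T : measurableType d) (R : realType) {d1 d2 : nat}.
Implicit Types M : T -> 'M[R]_(d1, d2).

(** The norm is a supremum over uncountably many vectors, so the countable family is found among
    matrices: [x < spectral_norm (M w)] exactly when [M w] is entrywise within some [r n] of a
    rational matrix whose norm exceeds [x + r n * D], where [r n * D] bounds the effect of the
    approximation. *)
Lemma measurable_spectral_norm M : measurable_mx M ->
  measurable_fun [set: T] (fun w => spectral_norm (M w)).
Proof.
move=> mM mT; apply: (measurability _ (RGenOInfty.measurableE R)) => //.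
move=> /= _ [_ [x ->] <-]; rewrite preimage_itvoy setTI.
pose r (n : nat) : R := n.+1%:R^-1; pose D : R := (d1 * d2)%:R.
pose box (B : 'M[rat]_(d1, d2)) n := [set w | forall i j, `|M w i j - ratr (B i j)| <= r n].
have r0 n : 0 <= r n by rewrite invr_ge0.
have close (A B : 'M[R]_(d1, d2)) n : (forall i j, `|A i j - B i j| <= r n) ->
    spectral_norm A <= spectral_norm B + r n * D.
  move=> AB; rewrite -[A](subrK B) addrC; apply: le_trans (spectral_normD _ _) _.
  rewrite lerD2l; apply: spectral_norm_le; first by rewrite mulr_ge0.
  by apply: op_bound_of_entries => // i j; rewrite !mxE.
have -> : [set w | x < spectral_norm (M w)] =
  \bigcup_(p : 'M[rat]_(d1, d2) * nat)
    (if x + r p.2 * D < spectral_norm (map_mx ratr p.1 : 'M[R]__) then box p.1 p.2 else set0).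
  apply/seteqP; split => [w /= xw|w [[B n] _ /=]].
    (* Twice the error: once for passing to the rational matrix, once for the margin required of
       it. *)
    have [n nx] : exists n, r n * (2 * D) < spectral_norm (M w) - x.
      pose y := (spectral_norm (M w) - x)^-1 * (2 * D).
      have y0 : 0 <= y by rewrite !mulr_ge0 ?invr_ge0 ?subr_ge0 ?ler0n// ltW.
      exists (Num.bound y); rewrite ltr_pdivrMl// -ltr_pdivrMr ?subr_gt0// [ltLHS]mulrC.
      by apply: lt_trans (archi_boundP y0) _; rewrite ltr_nat.
    have rn : 0 < r n by rewrite invr_gt0.
    have q_ex i j : exists q : rat, `|M w i j - ratr q| <= r n.
      have [|q] := @rat_in_itvoo R (M w i j - r n) (M w i j + r n); first by lra.
      by rewrite in_itv /= => /andP[q1 q2]; exists q; rewrite ler_norml; apply/andP; split; lra.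
    pose B : 'M[rat]_(d1, d2) := \matrix_(i, j) sval (cid (q_ex i j)).
    have AB i j : `|M w i j - (map_mx ratr B : 'M[R]_(d1, d2)) i j| <= r n.
      by rewrite !mxE; case: cid.
    exists (B, n) => //=.
    rewrite ifT; last by have := close _ _ _ AB; lra.
    by move=> i j; have := AB i j; rewrite !mxE.
  case: ifPn => // xB wB; have : spectral_norm (map_mx ratr B : 'M[R]_(d1, d2)) <= spectral_norm (M w) + r n * D.
    by apply: close => i j; rewrite !mxE distrC; exact: wB.
  lra.
apply: countable_bigcupT_measurable; first exact: countableP.
move=> [B n] /=; case: ifP => // _.
have -> : box B n = \bigcap_(p : 'I_d1 * 'I_d2)
    ((fun w => M w p.1 p.2) @^-1` [set y | `|y - ratr (B p.1 p.2)| <= r n]).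
  by apply/seteqP; split => [w h p _|w h i j]; [exact: h|exact: (h (i, j))].
apply: fin_bigcap_measurable => [|p _]; first exact: finite_finset.
rewrite -[_ @^-1` _]setTI; apply: mM => //.
have -> : [set y : R | `|y - ratr (B p.1 p.2)| <= r n] =
    `[ratr (B p.1 p.2) - r n, ratr (B p.1 p.2) + r n]%classic.
  by apply/seteqP; split => y /=; rewrite in_itv /= ler_distl.
exact: measurable_itv.
Qed.

End measurable_matrices.

(** * Discretisation *)

Section discretisation.
Context dU (U : measurableType dU) (R : realType) {d1 d2 : nat}.

(* Cells record which grid thresholds each entry exceeds; [M] picks a
   representative value in each cell, so it inherits the bound [r] exactly. *)
Lemma finite_discretisation (Xi : U -> 'M[R]_(d1, d2)) r e :
  measurable_mx Xi -> 0 <= r -> (forall u, op_bound (Xi u) r) -> 0 < e ->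
  exists (G : finType) (c : U -> G) (M : G -> 'M[R]_(d1, d2)),
    [/\ forall g, measurable (c @^-1` [set g]), forall g, op_bound (M g) r &
        forall u, op_bound (Xi u - M (c u)) e].
Proof.
(* [h] is the mesh: entries in one cell differ by at most [h], hence matrices by [h * D <= e]. The
   [+ 1] keeps the denominator positive for matrices without entries. *)
move=> mXi r0 Xir e0; pose D : R := (d1 * d2)%:R; pose h := e / (D + 1).
have h0 : 0 < h by rewrite divr_gt0// ltr_wpDl.
pose N := Num.bound (2 * r / h).
have rh0 : 0 <= 2 * r / h by rewrite divr_ge0 ?(ltW h0)// mulr_ge0.
have rN : 2 * r / h < N%:R := archi_boundP rh0.
pose above (p : 'I_d1 * 'I_d2 * 'I_N) u : bool := - r + p.2%:R * h <= Xi u p.1.1 p.1.2.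
pose c u := [ffun p => above p u].
(* The entry at [u'] passes its own grid threshold, of index [k], hence so does the entry at [u],
   which lies in the same cell. The choice of [N] guarantees [k < N]. *)
have c_le u u' i j : c u = c u' -> Xi u' i j <= Xi u i j + h.
  move=> cuu'; rewrite leNgt; apply/negP => lt_h.
  have y0 : 0 <= (Xi u' i j + r) / h.
    rewrite divr_ge0 ?(ltW h0)//; have := op_bound_entry i j (Xir u').
    by rewrite ler_norml => /andP[? ?]; lra.
  have /andP[k1 k2] := Num.Theory.truncn_itv y0.
  set k := Num.truncn _ in k1 k2.
  have kN : (k < N)%N.
    rewrite -(ltr_nat R); apply: le_lt_trans k1 _; apply: le_lt_trans rN.
    rewrite ler_wpM2r ?invr_ge0 ?(ltW h0)//; have := op_bound_entry i j (Xir u').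
    by rewrite ler_norml => /andP[? ?]; lra.
  rewrite ler_pdivlMr// in k1; rewrite ltr_pdivrMr// -natr1 in k2.
  have : c u (i, j, Ordinal kN) = c u' (i, j, Ordinal kN) by rewrite cuu'.
  rewrite !ffunE /above /=.
  have -> : - r + k%:R * h <= Xi u' i j by lra.
  by move/idP; lra.
(* Empty cells receive the zero matrix, which obeys the bound since [0 <= r]. *)
pose M g : 'M[R]_(d1, d2) :=
  if pselect (exists u, c u = g) is left ex then Xi (sval (cid ex)) else 0.
exists {ffun 'I_d1 * 'I_d2 * 'I_N -> bool}, c, M; split.
- move=> g; have -> : c @^-1` [set g] = \bigcap_p [set u | above p u = g p].
    apply/seteqP; split => [u <- p _|u h' /=]; first by rewrite /= ffunE.
    by apply/ffunP => p; rewrite ffunE; exact: h'.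
  apply: fin_bigcap_measurable => [|p _]; first exact: finite_finset.
  have mp : measurable [set u | above p u].
    rewrite -[X in measurable X]setTI.
    have := mXi p.1.1 p.1.2 measurableT `[- r + p.2%:R * h, +oo[%classic (measurable_itv _).
    by congr (measurable (_ `&` _)); apply/seteqP; split => u /=; rewrite in_itv /= andbT.
  case: (g p) => //.
  rewrite (_ : [set _ | _] = ~` [set u | above p u]); first exact: measurableC.
  by apply/seteqP; split => u /= => [->//|/negP/negbTE].
- move=> g; rewrite /M; case: pselect => // _ y.
  by rewrite mul0mx euclidean_norm0 mulr_ge0// euclidean_norm_ge0.
- move=> u; have -> : M (c u) = Xi (sval (cid (ex_intro (fun v => c v = c u) u erefl))).
    rewrite /M; case: pselect => [ex|[]]; last by exists u.
    by rewrite (Prop_irrelevance ex (ex_intro (fun v => c v = c u) u erefl)).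
  case: cid => v /= cvu.
  apply: (@op_boundW _ _ _ _ (h * D)).
    apply: op_bound_of_entries => [|i j]; first exact: ltW.
    have h1 := c_le _ _ i j cvu; have h2 := c_le _ _ i j (esym cvu).
    by rewrite !mxE ler_norml; apply/andP; split; lra.
  by rewrite /h mulrAC ler_pdivrMr ?ltr_wpDl// ler_wpM2l ?(ltW e0)// lerDl.
Qed.

End discretisation.

(** * Expectations of bounded random matrices *)

Section matrix_expectation.
Context d (T : measurableType d) (R : realType) (P : probability T R).

Definition bounded_mx m n (N : T -> 'M[R]_(m, n)) : Prop :=
  forall i j, bounded_mfun (fun w => N w i j).

Lemma bounded_mx_trmx m n (N : T -> 'M[R]_(m, n)) :
  bounded_mx N -> bounded_mx (fun w => (N w)^T).
Proof. by move=> bN i j; under eq_fun do rewrite mxE; exact: bN. Qed.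

Lemma bounded_mxM m n p (N : T -> 'M[R]_(m, n)) (N' : T -> 'M[R]_(n, p)) :
  bounded_mx N -> bounded_mx N' -> bounded_mx (fun w => N w *m N' w).
Proof.
move=> bN bN' i j; under eq_fun do rewrite mxE.
by apply: bounded_mfun_sum => k; exact: bounded_mfunM.
Qed.

Let dot_mulmxE m n (N : T -> 'M[R]_(m, n)) x y :
  (fun w => dot x (N w *m y)) =
  (fun w => \sum_i \sum_j (x i 0 * y j 0) * N w i j).
Proof.
apply/funext => w; apply: eq_bigr => i _; rewrite mxE mulr_sumr.
by apply: eq_bigr => j _; ring.
Qed.

Lemma bounded_mfun_dot m n (N : T -> 'M[R]_(m, n)) x y :
  bounded_mx N -> bounded_mfun (fun w => dot x (N w *m y)).
Proof.
move=> bN; rewrite dot_mulmxE; apply: bounded_mfun_sum => i.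
by apply: bounded_mfun_sum => j; apply: bounded_mfunZ; exact: bN.
Qed.

Lemma expect_dot m n (N : T -> 'M[R]_(m, n)) x y : bounded_mx N ->
  expect P (fun w => dot x (N w *m y)) = dot x (expectation_mx P N *m y).
Proof.
move=> bN; rewrite dot_mulmxE.
have bZ i j : bounded_mfun (fun w => (x i 0 * y j 0) * N w i j) by apply: bounded_mfunZ; exact: bN.
rewrite expect_sum => [|i]; last exact: bounded_mfun_sum.
apply: eq_bigr => i _; rewrite expect_sum// mxE mulr_sumr.
by apply: eq_bigr => j _; rewrite expectZ// mxE -/(expect P _); ring.
Qed.

End matrix_expectation.

(** * Tail bound for every other block *)

Section blocks.
Context d (T : measurableType d) (R : realType) (P : probability T R).
Context dU (U : measurableType dU) (X : int -> {mfun T >-> U}) {d1 d2 : nat}.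
Variables (Xi : U -> 'M[R]_(d1, d2)) (r sigma beta : R) (q e K : nat).
Hypothesis mXi : measurable_mx Xi.
Hypothesis r_ge0 : 0 <= r.
Hypothesis Xi_le : forall u, op_bound (Xi u) r.
Hypothesis Xi_mean : forall i, expectation_mx P (fun w => Xi (X i w)) = 0.
Hypothesis q_gt0 : (0 < q)%N.
Hypothesis beta_ge : (beta_coef P X q <= beta%:E)%E.

(* The [i]-th time of the [k]-th block of the sequence of every other block that
   starts with block [e]. *)
Definition block_time k (i : 'I_q) : int := (q * (2 * k + e) + i + 1)%N%:Z.

Hypothesis sigma_ge0 : 0 <= sigma.
Hypothesis sigma_var : forall k i j, (k < K)%N ->
  op_bound (expectation_mx P (fun w =>
    Xi (X (block_time k i) w) *m (Xi (X (block_time k j) w))^T)) sigma /\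
  op_bound (expectation_mx P (fun w =>
    (Xi (X (block_time k i) w))^T *m Xi (X (block_time k j) w))) sigma.

Definition block_sum k w : 'M[R]_(d1, d2) := \sum_(i < q) Xi (X (block_time k i) w).

Let mXiX i : measurable_mx (fun w => Xi (X i w)).
Proof. by move=> a b; apply: measurableT_comp (mXi a b) _. Qed.

Let bXiX i : bounded_mx (fun w => Xi (X i w)).
Proof.
move=> a b; split; first exact: mXiX.
by exists r => w; exact: op_bound_entry.
Qed.

Lemma expect_dot_block_sum k x y : expect P (fun w => dot x (block_sum k w *m y)) = 0.
Proof.
under eq_fun do rewrite mulmx_suml dot_sumr.
rewrite expect_sum => [|i]; last by apply: bounded_mfun_dot; exact: bXiX.
by rewrite big1// => i _; rewrite expect_dot// Xi_mean mul0mx dot0r.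
Qed.

(** The square expands into [q ^ 2] cross terms, each a quadratic form of a second moment bounded by
    [sigma], whatever the dependence inside the block. *)
Lemma expect_sqr_block_sum k y : (k < K)%N ->
  expect P (fun w => euclidean_norm (block_sum k w *m y) ^+ 2) <=
    q%:R ^+ 2 * sigma * euclidean_norm y ^+ 2.
Proof.
move=> kK; pose N i w := Xi (X (block_time k i) w).
have E w : euclidean_norm (block_sum k w *m y) ^+ 2 =
    \sum_i \sum_j dot y (((N i w)^T *m N j w) *m y).
  rewrite sqr_euclidean_norm /block_sum mulmx_suml dot_sumr [RHS]exchange_big /=.
  apply: eq_bigr => j _; rewrite dotC dot_sumr; apply: eq_bigr => i _.
  by rewrite dotC dot_mulmx mulmxA.
under eq_fun do rewrite E.
have bN i j : bounded_mx (fun w => (N i w)^T *m N j w).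
  by apply: bounded_mxM; [apply: bounded_mx_trmx|]; exact: bXiX.
rewrite expect_sum => [|i]; last by apply: bounded_mfun_sum => j; exact: bounded_mfun_dot.
have -> : q%:R ^+ 2 * sigma * euclidean_norm y ^+ 2 =
    \sum_(i < q) \sum_(j < q) sigma * euclidean_norm y ^+ 2.
  by rewrite !sumr_const !card_ord -mulrnA -[RHS]mulr_natl natrM; ring.
apply: ler_sum => i _; rewrite expect_sum => [|j]; last exact: bounded_mfun_dot.
apply: ler_sum => j _; rewrite expect_dot//.
have [_ s] := sigma_var i j kK.
by apply: le_trans (ler_norm _) _; apply: le_trans (op_bound_dot _ _ s) _; rewrite -mulrA -expr2.
Qed.

(** The other half of the squared norm of the dilation, from the moments with the transpose on the
    right. *)
Lemma expect_sqr_trmx_block_sum k x : (k < K)%N ->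
  expect P (fun w => euclidean_norm ((block_sum k w)^T *m x) ^+ 2) <=
    q%:R ^+ 2 * sigma * euclidean_norm x ^+ 2.
Proof.
move=> kK; pose N i w := Xi (X (block_time k i) w).
have E w : euclidean_norm ((block_sum k w)^T *m x) ^+ 2 =
    \sum_i \sum_j dot x ((N i w *m (N j w)^T) *m x).
  rewrite sqr_euclidean_norm /block_sum linear_sum /= mulmx_suml dot_sumr [RHS]exchange_big /=.
  apply: eq_bigr => j _; rewrite dotC dot_sumr; apply: eq_bigr => i _.
  by rewrite dotC dot_mulmx trmxK mulmxA.
under eq_fun do rewrite E.
have bN i j : bounded_mx (fun w => N i w *m (N j w)^T).
  by apply: bounded_mxM; [|apply: bounded_mx_trmx]; exact: bXiX.
rewrite expect_sum => [|i]; last by apply: bounded_mfun_sum => j; exact: bounded_mfun_dot.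
have -> : q%:R ^+ 2 * sigma * euclidean_norm x ^+ 2 =
    \sum_(i < q) \sum_(j < q) sigma * euclidean_norm x ^+ 2.
  by rewrite !sumr_const !card_ord -mulrnA -[RHS]mulr_natl natrM; ring.
apply: ler_sum => i _; rewrite expect_sum => [|j]; last exact: bounded_mfun_dot.
apply: ler_sum => j _; rewrite expect_dot//.
have [s _] := sigma_var i j kK.
by apply: le_trans (ler_norm _) _; apply: le_trans (op_bound_dot _ _ s) _; rewrite -mulrA -expr2.
Qed.

Let bounded_mx_block_sum k : bounded_mx (block_sum k).
Proof.
move=> a b; under eq_fun do rewrite summxE.
by apply: bounded_mfun_sum => i; exact: bXiX.
Qed.

Lemma op_bound_block_sum k w : op_bound (block_sum k w) (q%:R * r).
Proof.
have -> : q%:R * r = \sum_(i < q) r by rewrite sumr_const card_ord mulr_natl.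
by apply: op_bound_sum => i _; exact: Xi_le.
Qed.

Section discretised.
Context {G : finType} (c : U -> G) (M : G -> 'M[R]_(d1, d2)) (rho : R).
Hypothesis rho_ge0 : 0 <= rho.
Hypothesis mc : forall g, measurable (c @^-1` [set g]).
Hypothesis M_le : forall g, op_bound (M g) r.
Hypothesis Xi_M : forall u, op_bound (Xi u - M (c u)) (rho / q%:R).

Let Y k w : {ffun 'I_q -> G} := [ffun i => c (X (block_time k i) w)].
Let MY (g : {ffun 'I_q -> G}) : 'M[R]_(d1, d2) := \sum_i M (g i).
Let pY k g := prob P (Y k @^-1` [set g]).
Let L := q%:R * r.

(** [past_time k + q] is the first time of block [k], while the previous block of the same parity
    ends at [past_time k - 1]: the skipped block provides the gap [q]. The subtraction is in the
    integers because the result can be negative for [k = e = 0]. *)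
Let past_time k : int := (q * (2 * k + e) + 1)%N%:Z - q%:Z.
Let FA k := sigma_process X [set j | j <= past_time k].
Let FB k := sigma_process X [set j | past_time k + q%:Z <= j].

Let Y_FB k g : FB k (Y k @^-1` [set g]).
Proof.
have -> : Y k @^-1` [set g] =
    \bigcap_(i in [set: 'I_q]) X (block_time k i) @^-1` (c @^-1` [set g i]).
  apply/seteqP; split => [w <- i _|w h]; first by rewrite /= ffunE.
  by apply/ffunP => i; rewrite ffunE; exact: h.
by apply: sigma_process_bigcap => // i; rewrite /= /past_time /block_time; lia.
Qed.

Let past_FA k (h : {ffun 'I_k -> {ffun 'I_q -> G}}) :
  FA k ((fun w => [ffun j : 'I_k => Y j w]) @^-1` [set h]).
Proof.
have -> : (fun w => [ffun j : 'I_k => Y j w]) @^-1` [set h] =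
    \bigcap_(p in [set: 'I_k * 'I_q]) X (block_time p.1 p.2) @^-1` (c @^-1` [set h p.1 p.2]).
  apply/seteqP; split => [w <- p _|w hw]; first by rewrite /= !ffunE.
  by apply/ffunP => j; rewrite ffunE; apply/ffunP => i; rewrite ffunE; exact: (hw (j, i)).
apply: sigma_process_bigcap => // -[j i]; rewrite /= /past_time /block_time.
have : (q * (2 * j + e) + i + 1 + q <= q * (2 * k + e) + 1)%N.
  have := ltn_ord i; have jk := ltn_ord j.
  have : (q * (2 * j.+1 + e) <= q * (2 * k + e))%N by rewrite leq_mul2l; apply/orP; right; lia.
  rewrite !mulnDr mulnS; lia.
lia.
Qed.

Let FA_meas k : FA k `<=` measurable. Proof. exact: sigma_process_measurable. Qed.
Let FB_meas k : FB k `<=` measurable. Proof. exact: sigma_process_measurable. Qed.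

Let beta_dep_le k : (beta_dep P (FA k) (FB k) <= beta%:E)%E.
Proof. by apply: le_trans beta_ge; apply: ereal_sup_ubound; exists (past_time k). Qed.

Let mY k g : measurable (Y k @^-1` [set g]).
Proof. exact: FB_meas. Qed.

Lemma op_bound_block_sumB k w : op_bound (block_sum k w - MY (Y k w)) rho.
Proof.
have -> : block_sum k w - MY (Y k w) = \sum_(i < q)
    (Xi (X (block_time k i) w) - M (c (X (block_time k i) w))).
  by rewrite /block_sum /MY -sumrB; apply: eq_bigr => i _; rewrite ffunE.
have -> : rho = \sum_(i < q) rho / q%:R.
  by rewrite sumr_const card_ord -[RHS]mulr_natl mulrC divfK// pnatr_eq0 -lt0n.
by apply: op_bound_sum => i _; exact: Xi_M.
Qed.

Lemma op_bound_MY g : op_bound (MY g) L.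
Proof.
have -> : L = \sum_(i < q) r by rewrite /L sumr_const card_ord mulr_natl.
by apply: op_bound_sum => i _; exact: M_le.
Qed.

Let L_ge0 : 0 <= L. Proof. exact: mulr_ge0. Qed.

(** The exact block sum has mean zero, and discretising moves it by at most [rho] in operator norm;
    this is the [eta] of [chain_tail]. *)
Lemma mean_MY k u :
  \sum_g pY k g * dot u (dilation (MY g) *m u) <= rho * euclidean_norm u ^+ 2.
Proof.
rewrite -(expect_finite_valued P (mY k) (fun g => dot u (dilation (MY g) *m u))).
pose f w := 2 * dot (usubmx u) (block_sum k w *m dsubmx u).
have bf : bounded_mfun f by apply: bounded_mfunZ; exact: bounded_mfun_dot.
have -> : rho * euclidean_norm u ^+ 2 = expect P (fun w => f w + rho * euclidean_norm u ^+ 2).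
  rewrite expectD//; last exact: bounded_mfun_cst.
  by rewrite expect_cst expectZ ?expect_dot_block_sum ?mulr0 ?add0r//; exact: bounded_mfun_dot.
apply: expect_le; first exact: (bounded_mfun_finite_valued (mY k) (fun g => dot u (dilation (MY g) *m u))).
  by apply: bounded_mfunD => //; exact: bounded_mfun_cst.
move=> w; rewrite /f -dot_dilation vsubmxK.
have h := op_bound_dot u u (op_bound_dilation rho_ge0 (@op_bound_block_sumB k w)).
have E : dilation (block_sum k w) = dilation (block_sum k w - MY (Y k w)) + dilation (MY (Y k w)).
  by rewrite -dilationD subrK.
rewrite E mulmxDl dotDr; move: h; rewrite -mulrA -expr2 ler_norml => /andP[h _]; lra.
Qed.

(** The squared norm of the dilated block sum splits over the two halves of [u], with one moment
    bound for each. Discretising adds at most [rho * nrm u] to the norm, and the cross term of the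
    square uses the sure bound [L]. *)
Lemma var_MY k u : (k < K)%N ->
  \sum_g pY k g * euclidean_norm (dilation (MY g) *m u) ^+ 2 <=
    (q%:R ^+ 2 * sigma + 2 * rho * L + rho ^+ 2) * euclidean_norm u ^+ 2.
Proof.
move=> kK.
rewrite -(expect_finite_valued P (mY k) (fun g => euclidean_norm (dilation (MY g) *m u) ^+ 2)).
set x := usubmx u; set y := dsubmx u.
have sqr_bounded m n (N : T -> 'M[R]_(m, n)) z : bounded_mx N ->
    bounded_mfun (fun w => euclidean_norm (N w *m z) ^+ 2).
  move=> bN; under eq_fun do rewrite sqr_euclidean_norm dot_mulmx mulmxA.
  by apply: bounded_mfun_dot; apply: bounded_mxM => //; exact: bounded_mx_trmx.
pose f1 w := euclidean_norm (block_sum k w *m y) ^+ 2.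
pose f2 w := euclidean_norm ((block_sum k w)^T *m x) ^+ 2.
have bf1 : bounded_mfun f1 by exact: sqr_bounded.
have bf2 : bounded_mfun f2 by apply: sqr_bounded; exact: bounded_mx_trmx.
pose a := (2 * rho * L + rho ^+ 2) * euclidean_norm u ^+ 2.
apply: (@le_trans _ _ (expect P (fun w => f1 w + f2 w + a))).
  apply: expect_le; first exact: (bounded_mfun_finite_valued (mY k) (fun g => euclidean_norm (dilation (MY g) *m u) ^+ 2)).
    by apply: bounded_mfunD; [exact: bounded_mfunD|exact: bounded_mfun_cst].
  move=> w; rewrite /f1 /f2 -sqr_norm_dilation vsubmxK /a.
  have h1 := op_bound_dilation rho_ge0 (@op_bound_block_sumB k w) u.
  have h2 := op_bound_dilation L_ge0 (@op_bound_block_sum k w) u.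
  set z := dilation (block_sum k w) *m u in h2 *.
  have h3 : euclidean_norm (dilation (MY (Y k w)) *m u) <= euclidean_norm z + rho * euclidean_norm u.
    have -> : dilation (MY (Y k w)) *m u = z + (- 1) *: (dilation (block_sum k w - MY (Y k w)) *m u).
      by rewrite dilationD dilationN mulmxBl scaleN1r opprB addrC subrK.
    apply: le_trans (euclidean_normD _ _) _; rewrite lerD2l.
    by rewrite euclidean_normZ normrN1 mul1r.
  have u0 := euclidean_norm_ge0 u; have z0 := euclidean_norm_ge0 z.
  have n0 := euclidean_norm_ge0 (dilation (MY (Y k w)) *m u).
  apply: (@le_trans _ _ ((euclidean_norm z + rho * euclidean_norm u) ^+ 2)).
    by apply: lerXn2r => //; rewrite nnegrE ?(le_trans n0 h3).
  have : rho * euclidean_norm u * euclidean_norm z <= rho * euclidean_norm u * (L * euclidean_norm u).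
    by rewrite ler_wpM2l// mulr_ge0.
  move: (euclidean_norm u) (euclidean_norm z) => s v hs.
  rewrite sqrrD; nra.
rewrite expectD//; last 2 first.
- exact: bounded_mfunD.
- exact: bounded_mfun_cst.
rewrite expectD// expect_cst /a.
have h1 := expect_sqr_block_sum y kK; have h2 := expect_sqr_trmx_block_sum x kK.
have := sqr_norm_col_mx x y; rewrite vsubmxK => E.
rewrite E in h1 h2 *; move: h1 h2; rewrite -/f1 -/f2; lra.
Qed.

(** Discretising moves the sum by at most [K * rho < t / 10], the gap between [5 / 2 * t] and
    [12 / 5 * t]. Then the blocks are made independent at the cost of [beta] each, and [chain_tail]
    applies. *)
Lemma prob_block_sum_le t theta kappa :
  0 < t -> 0 <= theta -> theta * L <= 1 -> 0 < kappa -> K%:R * rho < t / 10 ->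
  prob P [set w | 5 / 2 * t <= spectral_norm (\sum_(k < K) block_sum k w)] <=
    K%:R * beta + (d1 + d2)%:R * expR (- (theta * (12 / 5 * t)) +
      K%:R * (theta * rho + 2 * (theta ^+ 2 * (q%:R ^+ 2 * sigma + 2 * rho * L + rho ^+ 2))) + kappa).
Proof.
move=> t0 theta0 thetaL kappa0 Krho.
set A := [set _ | _].
pose f (S : 'M[R]_(d1, d2)) : R := (12 / 5 * t < spectral_norm S)%R%:R.
pose Z w := \sum_(k < K) MY (Y k w).
have mA : measurable A.
  have mS : measurable_mx (fun w => \sum_(k < K) block_sum k w).
    move=> a b; under eq_fun do rewrite summxE; apply: measurable_sum => k.
    exact: (bounded_mx_block_sum k a b).1.
  have := measurable_spectral_norm mS measurableT (Y := `[5 / 2 * t, +oo[%classic) (measurable_itv _).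
  by rewrite setTI; congr (measurable _); apply/seteqP; split => w /=; rewrite in_itv /= andbT.
have fZ : bounded_mfun (fun w => f (Z w)).
  have mh h : measurable ((fun w => [ffun j : 'I_K => Y j w]) @^-1` [set h]).
    by apply: FA_meas; exact: past_FA.
  have := bounded_mfun_finite_valued mh (fun h => f (\sum_(k < K) MY (h k))).
  by congr bounded_mfun; apply/funext => w; congr f; apply: eq_bigr => k _; rewrite ffunE.
rewrite -(expect_indic P mA); apply: (@le_trans _ _ (expect P (fun w => f (Z w)))).
  apply: expect_le => // [|w]; first exact: bounded_mfun_indic.
  rewrite indicE; case: (boolP (w \in A)) => [|_]; last by rewrite ler0n.
  rewrite inE /A /= => h; rewrite /f.
  have ZS : spectral_norm (\sum_(k < K) block_sum k w) <= spectral_norm (Z w) + K%:R * rho.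
    have -> : \sum_(k < K) block_sum k w = Z w + \sum_(k < K) (block_sum k w - MY (Y k w)).
      by rewrite sumrB addrC subrK.
    apply: le_trans (spectral_normD _ _) _; rewrite lerD2l.
    have -> : K%:R * rho = \sum_(k < K) rho by rewrite sumr_const card_ord mulr_natl.
    apply: spectral_norm_le; first exact: sumr_ge0.
    by apply: op_bound_sum => k _; exact: op_bound_block_sumB.
  have -> // : 12 / 5 * t < spectral_norm (Z w) by lra.
apply: le_trans (expect_sum_le_chain_mean (fun=> MY) FA_meas FB_meas past_FA Y_FB beta_dep_le K _) _.
  by move=> S; rewrite /f; case: (_ < _); rewrite ?lexx ?ler01.
rewrite addrC lerD2l.
apply: (chain_tail _ _ L_ge0 theta0 thetaL) => //.
- by move=> k g; exact: prob_ge0.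
- by move=> k; exact: (sum_prob_finite_valued P (mY k)).
- by rewrite !addr_ge0 ?sqr_ge0// !mulr_ge0// ?exprn_ge0.
- by move=> k g; exact: op_bound_MY.
- by move=> k u _; exact: mean_MY.
- by move=> k u; exact: var_MY.
- by rewrite mulr_ge0// ltW.
Qed.

End discretised.

Lemma block_tail t D : 0 < t -> 0 < D ->
  K%:R * q%:R ^+ 2 * sigma <= D -> q%:R * r * t <= 3 * D ->
  prob P [set w | 5 / 2 * t <= spectral_norm (\sum_(k < K) block_sum k w)] <=
    K%:R * beta + (d1 + d2)%:R * expR (- t ^+ 2 / 2 / D).
Proof.
move=> t0 D0 KD rD; set L := q%:R * r.
have L0 : 0 <= L by rewrite mulr_ge0.
(* With this [theta], [theta * L <= 1] is the assumption [q * r * t <= 3 * D]. The target exponent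
   is [- tau / 2]. *)
pose theta := t / (3 * D); pose tau := t ^+ 2 / D.
have theta0 : 0 < theta by rewrite divr_gt0// mulr_gt0.
have tau0 : 0 < tau by rewrite divr_gt0// exprn_gt0.
have thetaL : theta * L <= 1.
  by rewrite /theta mulrAC ler_pdivrMr ?mulr_gt0// mul1r mulrC.
have thetat : theta * t = tau / 3 by rewrite /theta /tau; field; rewrite gt_eqF.
have thetaD : theta ^+ 2 * D = tau / 9 by rewrite /theta /tau; field; rewrite gt_eqF.
(* [A] collects the coefficients of [rho] in the exponent and in [K * rho], so that
   [rho = mu / (1 + A)] keeps these terms below [mu]. The three bounds on [mu] serve the exponent,
   the condition [K * rho < t / 10], and [rho ^+ 2 <= rho]. *)
pose A := K%:R * theta + 2 * (K%:R * theta ^+ 2 * (2 * L + 1)) + K%:R.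
have A1 : 0 <= K%:R * theta by rewrite mulr_ge0// ltW.
have A3 : 0 <= K%:R * theta ^+ 2 by rewrite mulr_ge0// sqr_ge0.
have A2 : 0 <= K%:R * theta ^+ 2 * (2 * L + 1) by apply: mulr_ge0 => //; lra.
have A0 : 0 <= A by rewrite /A addr_ge0// addr_ge0// mulr_ge0.
pose mu := Num.min (Num.min (tau / 100) (t / 20)) 1.
have mu0 : 0 < mu by rewrite /mu !lt_min; apply/andP; split; [apply/andP; split|]; lra.
have [mu1 mu2 mu3] : [/\ mu <= tau / 100, mu <= t / 20 & mu <= 1].
  by rewrite /mu !ge_min !lexx !orbT; split.
pose rho := mu / (1 + A).
have A1p : 0 < 1 + A by rewrite ltr_pwDl.
have rho0 : 0 < rho by rewrite divr_gt0.
have rhoA : rho * (1 + A) = mu by rewrite /rho divfK// gt_eqF.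
have rho1 : rho <= 1 by apply: le_trans mu3; rewrite -rhoA ler_pMr// lerDl.
have q0 : 0 < q%:R :> R by rewrite ltr0n.
have [G [c [M [mc M_le Xi_M]]]] := finite_discretisation mXi r_ge0 Xi_le (divr_gt0 rho0 q0).
have Krho : K%:R * rho < t / 10.
  have : K%:R * rho <= mu.
    by rewrite -rhoA mulrC ler_wpM2l ?(ltW rho0)// /A addrA lerDr addr_ge0// addr_ge0// mulr_ge0.
  lra.
have kappa0 : 0 < tau / 100 by rewrite divr_gt0.
apply: le_trans (prob_block_sum_le (ltW rho0) mc M_le Xi_M t0 (ltW theta0) thetaL kappa0 Krho) _.
rewrite lerD2l ler_wpM2l// ler_expR -/L.
have -> : - t ^+ 2 / 2 / D = - (tau / 2) by rewrite /tau; field; rewrite gt_eqF.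
have h1 : K%:R * theta ^+ 2 * (q%:R ^+ 2 * sigma) <= tau / 9.
  rewrite -thetaD (mulrC K%:R) -mulrA ler_wpM2l ?sqr_ge0//; move: KD; lra.
have h2 : K%:R * theta * rho + 2 * (K%:R * theta ^+ 2 * (2 * rho * L + rho ^+ 2)) <= tau / 100.
  apply: le_trans mu1; rewrite -rhoA.
  have : K%:R * theta ^+ 2 * (2 * rho * L + rho ^+ 2) <= K%:R * theta ^+ 2 * (rho * (2 * L + 1)).
    apply: ler_wpM2l => //; rewrite expr2.
    have : rho * rho <= rho * 1 by rewrite ler_wpM2l// ltW.
    lra.
  have : 0 <= rho * (1 + K%:R) by rewrite mulr_ge0 ?(ltW rho0)// addr_ge0.
  rewrite /A; lra.
(* The exponent is at most [(- 4 / 5 + 2 / 9 + 1 / 100 + 1 / 100) * tau], which is below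
   [- tau / 2]. *)
have -> : theta * (12 / 5 * t) = 12 / 5 * (tau / 3) by rewrite -thetat; ring.
move: h1 h2; move: (q%:R ^+ 2 * sigma) => z.
lra.
Qed.

End blocks.

(** * Assembly *)

Section splitting.
Context {V : zmodType}.

(** The indices [2 * k + 0] and [2 * k + 1] have the shape of [block_time] for [e = 0] and
    [e = 1]. *)
Lemma sum_parity m (b : nat -> V) :
  \sum_(k < m) b k = \sum_(k < uphalf m) b (2 * k + 0)%N + \sum_(k < m./2) b (2 * k + 1)%N.
Proof.
elim: m => [|m IH]; first by rewrite !big_ord0 addr0.
rewrite big_ord_recr /= IH uphalf_half.
case: (boolP (odd m)) => om /=.
  rewrite add1n -addrA; congr (_ + _); rewrite [in RHS]big_ord_recr /=.
  by congr (_ + b _); have := odd_double_half m; rewrite om; lia.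
rewrite add0n [X in _ = X + _]big_ord_recr /= -!addrA; congr (_ + _); rewrite addrC.
by congr (b _ + _); have := odd_double_half m; rewrite (negbTE om); lia.
Qed.

Lemma sum_blocks q m (a : nat -> V) :
  \sum_(1 <= i < q * m + 1) a i = \sum_(k < m) \sum_(i < q) a (q * k + i + 1)%N.
Proof.
elim: m => [|m IH]; first by rewrite muln0 big_ord0 big_geq.
rewrite big_ord_recr /= -IH (big_cat_nat (n := (q * m + 1)%N)) /=; try lia.
congr (_ + _); rewrite -{1}[(q * m + 1)%N]add0n big_addn.
have -> : (q * m.+1 + 1 - (q * m + 1) = q)%N by rewrite mulnS; lia.
by rewrite big_mkord; apply: eq_bigr => i _; congr a; lia.
Qed.

End splitting.

(** * Almost sure modifications, and basic facts on [s2] and [beta_coef] *)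

Section ae_invariance.
Context d (T : measurableType d) (R : realType) (P : probability T R).

Lemma le_measure_ae (A B : set T) : measurable A -> measurable B ->
  {ae P, forall w, A w -> B w} -> (P A <= P B)%E.
Proof.
move=> mA mB [N [mN N0 AB]].
apply: (@le_trans _ _ (P (B `|` N))).
  apply: le_measure; rewrite ?inE//; first exact: measurableU.
  by move=> w Aw; have [Bw|nBw] := pselect (B w); [left|right; apply: AB => /(_ Aw)].
by rewrite -[leRHS]adde0 -N0; exact: measureU2.
Qed.

Lemma expectation_mx_ae m n (N N' : T -> 'M[R]_(m, n)) :
  measurable_mx N -> measurable_mx N' -> {ae P, forall w, N w = N' w} ->
  expectation_mx P N = expectation_mx P N'.
Proof.
move=> mN mN' NN'; apply/matrixP => i j; rewrite !mxE !unlock; congr fine.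
apply: ae_eq_integral => //; try exact/measurable_EFinP.
by apply: filterS NN' => w E _; rewrite /= E.
Qed.

Lemma measurable_mx_trmx m n (N : T -> 'M[R]_(m, n)) :
  measurable_mx N -> measurable_mx (fun w => (N w)^T).
Proof. by move=> mN i j; under eq_fun do rewrite mxE; exact: mN. Qed.

Lemma measurable_mxM m n p (N : T -> 'M[R]_(m, n)) (N' : T -> 'M[R]_(n, p)) :
  measurable_mx N -> measurable_mx N' -> measurable_mx (fun w => N w *m N' w).
Proof.
move=> mN mN' i j; under eq_fun do rewrite mxE.
by apply: measurable_sum => k; apply: measurable_funM; [exact: mN|exact: mN'].
Qed.

Lemma measurable_mx_sum m n (I : Type) (s : seq I) (N : I -> T -> 'M[R]_(m, n)) :
  (forall i, measurable_mx (N i)) -> measurable_mx (fun w => \sum_(i <- s) N i w).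
Proof.
move=> mN i j; under eq_fun do rewrite summxE.
by apply: measurable_sum => k; exact: mN.
Qed.

Lemma measurable_spectral_norm_ge m n (N : T -> 'M[R]_(m, n)) c :
  measurable_mx N -> measurable [set w | c <= spectral_norm (N w)].
Proof.
move=> mN; have := measurable_spectral_norm mN measurableT (Y := `[c, +oo[%classic) (measurable_itv _).
by rewrite setTI; congr (measurable _); apply/seteqP; split => w /=; rewrite in_itv /= andbT.
Qed.

Lemma s2_ge0 m n (N : nat -> T -> 'M[R]_(m, n)) k : 0 <= s2 P N k.
Proof. exact: bigmax_ge_id. Qed.

Lemma op_bound_s2 m n (N : nat -> T -> 'M[R]_(m, n)) k i j :
  (1 <= i <= k)%N -> (1 <= j <= k)%N ->
  op_bound (expectation_mx P (fun w => N i w *m (N j w)^T)) (s2 P N k) /\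
  op_bound (expectation_mx P (fun w => (N i w)^T *m N j w)) (s2 P N k).
Proof.
move=> ik jk; set x := expectation_mx _ _; set y := expectation_mx _ _.
have h : Num.max (spectral_norm x) (spectral_norm y) <= s2 P N k.
  apply: (bigmax_sup_seq _ i) => //; first by rewrite mem_index_iota ltnS.
  by apply: (bigmax_sup_seq _ j) => //; rewrite mem_index_iota ltnS.
by move: h; rewrite ge_max => /andP[h1 h2]; split; apply: op_boundW (op_bound_spectral_norm _) _.
Qed.

(** The one-cell partition gives a nonnegative element of the supremum; its cell is nonempty because
    the total mass is 1. *)
Lemma beta_coef_ge0 dU (U : measurableType dU) (X : int -> {mfun T >-> U}) q :
  (0 <= beta_coef P X q)%E.
Proof.
pose FA := sigma_process X [set k | k <= 0]; pose FB := sigma_process X [set k | 0 + q%:Z <= k].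
have sT K : sigma_process X K [set: T].
  (* The whole space is an intersection over the empty index type, whatever [K] is. *)
  have := sigma_process_bigcap (X := X) (K := K) (I := void) (s := fun=> 0) (B := fun=> setT).
  have -> : \bigcap_(i in [set: void]) X 0 @^-1` [set: U] = [set: T] by apply/seteqP; split => // w _ [].
  by apply => -[].
have T0 : [set: T] !=set0.
  apply/set0P/negP => /eqP T0; have := probability_setT P; rewrite T0 measure0.
  by move/eqP; rewrite eq_sym onee_eq0.
have pT : partition [set: 'I_1] (fun=> [set: T]) [set: T].
  by split => //; [apply/seteqP; split => // w _; exists ord0|move=> i j _ _ _; rewrite !ord1].
apply: (@le_trans _ _ (beta_dep P FA FB)); last by apply: ereal_sup_ubound; exists 0.
rewrite mule_ge0 ?lee_fin ?invr_ge0//.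
apply: (@le_trans _ _ (\sum_(i < 1) \sum_(j < 1) `|P ([set: T] `&` [set: T]) - P [set: T] * P [set: T]|)%E).
  by apply: sume_ge0 => i _; apply: sume_ge0 => j _; exact: abse_ge0.
by apply: ereal_sup_ubound; exists 1%N, 1%N, (fun=> setT), (fun=> setT); split => //; first [exact: pT|move=> _; exact: sT].
Qed.

End ae_invariance.

(** * The tail bound for an everywhere bounded function *)

Section bounded_case.
Context d (T : measurableType d) (R : realType) (P : probability T R).
Context dU (U : measurableType dU) (X : int -> {mfun T >-> U}) {d1 d2 : nat}.
Variables (Xi : U -> 'M[R]_(d1, d2)) (r beta t : R) (n q : nat).
Hypothesis mXi : measurable_mx Xi.
Hypothesis r_ge0 : 0 <= r.
Hypothesis Xi_le : forall u, op_bound (Xi u) r.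
Hypothesis Xi_mean : forall i, expectation_mx P (fun w => Xi (X i w)) = 0.
Hypothesis q_gt0 : (0 < q)%N.
Hypothesis beta_ge0 : 0 <= beta.
Hypothesis beta_ge : (beta_coef P X q <= beta%:E)%E.
Hypothesis t_gt0 : 0 < t.

Let sigma := s2 P (fun i w => Xi (X i%:Z w)) n.
Let D := n%:R * q%:R * sigma + q%:R * r * t / 3.
Hypothesis D_gt0 : 0 < D.

Let S (e : nat) K w : 'M[R]_(d1, d2) := \sum_(k < K) block_sum X Xi q e k w.

Let mXiX i : measurable_mx (fun w => Xi (X i w)).
Proof. by move=> a b; apply: measurableT_comp (mXi a b) _. Qed.

(** The blocks lie within the times [1] to [n], where [s2] applies. Since [K * q <= n], the first
    term of [D] dominates [K * q ^ 2 * sigma]; the second one gives [q * r * t <= 3 * D]. *)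
Let block_tail_parity e K : (forall k, (k < K)%N -> (2 * k + e < n %/ q)%N) ->
  prob P [set w | 5 / 2 * t <= spectral_norm (S e K w)] <=
    K%:R * beta + (d1 + d2)%:R * expR (- t ^+ 2 / 2 / D).
Proof.
move=> Ke; have mq := leq_trunc_div n q.
have s0 : 0 <= sigma by exact: s2_ge0.
apply: (block_tail mXi r_ge0 Xi_le Xi_mean q_gt0 beta_ge s0 _ t_gt0 D_gt0).
- move=> k i j kK; have kn i' : (i' < q)%N -> (1 <= q * (2 * k + e) + i' + 1 <= n)%N.
    move=> iq; rewrite addn1 ltnS leq0n /=; apply: leq_trans mq; rewrite (mulnC _ q).
    apply: (@leq_trans (q * (2 * k + e).+1)); first by rewrite mulnS; lia.
    by rewrite leq_mul2l Ke// orbT.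
  exact: (op_bound_s2 P (fun i w => Xi (X i%:Z w)) (kn i (ltn_ord i)) (kn j (ltn_ord j))).
- have Kn : (K * q <= n)%N.
    apply: leq_trans mq; rewrite leq_mul2r; apply/orP; right.
    by case: K Ke => // K' /(_ K' (ltnSn _)); lia.
  rewrite /D; apply: (@le_trans _ _ (n%:R * q%:R * sigma)).
    by rewrite expr2 mulrA ler_wpM2r ?s2_ge0// ler_wpM2r// -natrM ler_nat.
  by rewrite lerDl !mulr_ge0// ?invr_ge0// ltW.
- rewrite /D mulrDr -lerBlDr; have : 0 <= n%:R * q%:R * sigma by rewrite !mulr_ge0// s2_ge0.
  lra.
Qed.

(** Union bound, from [6 = 5 / 2 + 5 / 2 + 1]. The two families have [n %/ q] blocks in all, whence
    the coefficient of [beta], and their equal exponentials give the factor 2. *)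
Lemma bounded_matrix_tail :
  (P [set w | (6 * t <= spectral_norm (\sum_(1 <= i < n.+1) Xi (X i%:Z w)))%R] <=
   (n%:R / q%:R * beta)%:E +
   P [set w | (t <= spectral_norm (\sum_(q * (n %/ q) + 1 <= i < n.+1) Xi (X i%:Z w)))%R] +
   (2 * (d1 + d2)%:R * expR (- t ^+ 2 / 2 / D))%:E)%E.
Proof.
set m := (n %/ q)%N; pose rem w := \sum_(q * m + 1 <= i < n.+1) Xi (X i%:Z w).
have mq : (m * q <= n)%N := leq_trunc_div n q.
have split_sum w : \sum_(1 <= i < n.+1) Xi (X i%:Z w) = S 0 (uphalf m) w + S 1 m./2 w + rem w.
  rewrite (big_cat_nat (n := (q * m + 1)%N)) /=; try lia.
  rewrite sum_blocks (sum_parity m (fun k => \sum_(i < q) Xi (X (q * k + i + 1)%N%:Z w))).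
  by rewrite /S /block_sum /block_time.
set A := [set _ | _]; set B := [set _ | _].
pose A0 := [set w | 5 / 2 * t <= spectral_norm (S 0 (uphalf m) w)].
pose A1 := [set w | 5 / 2 * t <= spectral_norm (S 1 m./2 w)].
have mS e K : measurable_mx (S e K) by do 2! apply: measurable_mx_sum => ?; exact: mXiX.
have mA : measurable A by apply: measurable_spectral_norm_ge; apply: measurable_mx_sum => i; exact: mXiX.
have mB : measurable B by apply: measurable_spectral_norm_ge; apply: measurable_mx_sum => i; exact: mXiX.
have mA0 : measurable A0 by exact: measurable_spectral_norm_ge.
have mA1 : measurable A1 by exact: measurable_spectral_norm_ge.
have AU : A `<=` A0 `|` A1 `|` B.
  move=> w; rewrite /A /= split_sum => h.
  have := spectral_normD (S 0 (uphalf m) w + S 1 m./2 w) (rem w).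
  have := spectral_normD (S 0 (uphalf m) w) (S 1 m./2 w).
  have [h0|h0] := leP (5 / 2 * t) (spectral_norm (S 0 (uphalf m) w)); first by left; left.
  have [h1|h1] := leP (5 / 2 * t) (spectral_norm (S 1 m./2 w)); first by left; right.
  by move=> h2 h3; right; rewrite /B /= -/(rem w); lra.
have PA : (P A <= P A0 + P A1 + P B)%E.
  apply: (@le_trans _ _ (P (A0 `|` A1 `|` B))).
    by apply: le_measure; rewrite ?inE//; do ?apply: measurableU.
  apply: le_trans (measureU2 _ _ _) _ => //; first exact: measurableU.
  by rewrite leeD2r// measureU2.
apply: le_trans PA _; rewrite !(probE P) // -!EFinD lee_fin.
have h0 : prob P A0 <= (uphalf m)%:R * beta + (d1 + d2)%:R * expR (- t ^+ 2 / 2 / D).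
  by apply: block_tail_parity => k; rewrite -/m; lia.
have h1 : prob P A1 <= (m./2)%:R * beta + (d1 + d2)%:R * expR (- t ^+ 2 / 2 / D).
  by apply: block_tail_parity => k; rewrite -/m; lia.
have hm : (uphalf m)%:R * beta + (m./2)%:R * beta <= n%:R / q%:R * beta.
  rewrite -mulrDl ler_wpM2r// ler_pdivlMr ?ltr0n// -natrD -natrM ler_nat.
  by rewrite (_ : uphalf m + m./2 = m)%N//; lia.
lra.
Qed.

End bounded_case.

(** * Degenerate cases and reduction to an everywhere bounded function *)

Theorem theorem5p2 (R : realType)
    (dT : measure_display) (T : measurableType dT) (P : probability T R)
    (dU : measure_display) (U : measurableType dU)
    (X : int -> {mfun T >-> U})
    (d1 d2 : nat) (Xi : nat -> U -> 'M[R]_(d1, d2)) (Rn : nat -> R)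
    (X_stationary : strictly_stationary P X)
    (X_mixing : beta_mixing P X)
    (Xi_measurable : forall n, measurable_mx (Xi n))
    (Xi_centered : forall n i, expectation_mx P (fun w => Xi n (X i w)) = 0)
    (Xi_bounded : forall n i,
       {ae P, forall w, spectral_norm (Xi n (X i w)) <= Rn n})
    (n q : nat) (q_ge1 : (1 <= q)%N) (q_le : (2 * q <= n)%N)
    (t : R) (t_ge0 : 0 <= t) :
  (P [set w | (6 * t <=
        spectral_norm (\sum_(1 <= i < n.+1) Xi n (X i%:Z w)))%R]
   <= (n%:R / q%:R)%:E * beta_coef P X q
      + P [set w | (t <=
          spectral_norm
            (\sum_(q * (n %/ q) + 1 <= i < n.+1) Xi n (X i%:Z w)))%R]
      + (2 * (d1 + d2)%:R *
         expR ((- t ^+ 2 / 2) /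
               (n%:R * q%:R * s2 P (fun i w => Xi n (X i%:Z w)) n
                + q%:R * Rn n * t / 3)))%:E)%E.
Proof.
(* A negative bound would make the exceptional null set the whole space. *)
have R0 : 0 <= Rn n.
  rewrite leNgt; apply/negP => Rn0; have [N [mN N0 sub]] := Xi_bounded n 0.
  have := probability_setT P; suff -> : [set: T] = N by rewrite N0 => /esym/eqP; rewrite onee_eq0.
  apply/seteqP; split => // w _; apply: sub => /= h.
  by have := le_lt_trans h Rn0; rewrite ltNge spectral_norm_ge0.
set D := _ + _ * t / 3.
set A := [set _ | _]; set B := [set _ | _].
have mXiX i : measurable_mx (fun w => Xi n (X i w)).
  by move=> a b; apply: measurableT_comp (Xi_measurable n a b) _.
have mA : measurable A.
  by apply: measurable_spectral_norm_ge; apply: measurable_mx_sum => i; exact: mXiX.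
have mB : measurable B.
  by apply: measurable_spectral_norm_ge; apply: measurable_mx_sum => i; exact: mXiX.
have b0 := beta_coef_ge0 P X q.
have nq0 : 0 < n%:R / q%:R :> R by rewrite divr_gt0 ?ltr0n//; lia.
have nqb0 : (0 <= (n%:R / q%:R)%:E * beta_coef P X q)%E by rewrite mule_ge0// lee_fin ltW.
set E := (2 * _ * _)%:E.
have E0 : (0 <= E)%E by rewrite lee_fin mulr_ge0 ?expR_ge0// mulr_ge0.
(* For [t = 0] the remainder event is the whole space, and the right-hand side is at least 1. *)
have [t0|t_neq0] := eqVneq t 0.
  have -> : B = setT by apply/seteqP; split => // w _; rewrite /B /= t0 spectral_norm_ge0.
  apply: (le_trans (probability_le1 P mA)); rewrite probability_setT.
  by rewrite -addeA addeCA leeDl// adde_ge0.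
have t1 : 0 < t by rewrite lt_neqAle eq_sym t_neq0.
have D0 : 0 <= D.
  by rewrite /D addr_ge0// ?mulr_ge0 ?invr_ge0 ?s2_ge0.
(* Division by zero yields 0, so for [D = 0] the exponential is 1 and [E = 2 * (d1 + d2) >= 1],
   unless [d1 = d2 = 0]; in that case every norm is 0, below [6 * t]. *)
have [D00|D_neq0] := eqVneq D 0.
  have [dd|dd] := eqVneq (d1 + d2)%N 0%N.
    have -> : A = set0.
      apply/seteqP; split => // w; rewrite /A /= leNgt => /negP; apply.
      apply: le_lt_trans (_ : _ <= 0) _; last by rewrite mulr_gt0.
      apply: spectral_norm_le => // y; rewrite mul0r.
      have -> : y = 0 by apply/colP => i; have := ltn_ord i; lia.
      by rewrite mulmx0 euclidean_norm0.
    by rewrite measure0 !adde_ge0.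
  apply: (le_trans (probability_le1 P mA)).
  apply: (@le_trans _ _ E); last by rewrite leeDr// adde_ge0.
  rewrite /E D00 invr0 mulr0 expR0 mulr1 lee_fin -natrM ler1n; lia.
have D1 : 0 < D by rewrite lt_neqAle eq_sym D_neq0.
case beq : (beta_coef P X q) b0 nqb0 => [b| |]; last by [].
  rewrite lee_fin => b0 _.
  (* Truncation makes the almost sure bound hold at every point of [U], as the discretisation
     requires. Along the process it changes values only on null sets, so moments and probabilities
     are preserved. *)
  pose Xi' u := if spectral_norm (Xi n u) <= Rn n then Xi n u else 0.
  have mXi' : measurable_mx Xi'.
    move=> i j; rewrite /Xi'.
    under eq_fun do rewrite (fun_if (fun M : 'M[R]_(d1, d2) => M i j)) mxE.
    apply: measurable_fun_ifT; [|exact: Xi_measurable|exact: measurable_cst].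
    apply: measurable_fun_ler; last exact: measurable_cst.
    exact: measurable_spectral_norm.
  have XiE i : {ae P, forall w, Xi' (X i w) = Xi n (X i w)}.
    by apply: filterS (Xi_bounded n i) => w; rewrite /Xi' => ->.
  have mXiX' i : measurable_mx (fun w => Xi' (X i w)).
    by move=> a b'; apply: measurableT_comp (mXi' a b') _.
  have XiE_all : {ae P, forall w, forall i : nat, Xi' (X i%:Z w) = Xi n (X i%:Z w)}.
    by apply: ae_foralln => i; exact: XiE.
  have Xi'_le u : op_bound (Xi' u) (Rn n).
    rewrite /Xi'; case: ifPn => [h|_]; first exact: op_boundW (op_bound_spectral_norm _) h.
    exact: op_boundW (@op_bound0 _ _ _) R0.
  have Xi'_mean i : expectation_mx P (fun w => Xi' (X i w)) = 0.
    by rewrite -(Xi_centered n i); exact: expectation_mx_ae.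
  have s2E : s2 P (fun i w => Xi n (X i%:Z w)) n = s2 P (fun i w => Xi' (X i%:Z w)) n.
    rewrite /s2; apply: eq_bigr => i _; apply: eq_bigr => j _.
    congr Num.max; congr spectral_norm; apply: expectation_mx_ae.
    - by apply: measurable_mxM => //; exact: measurable_mx_trmx.
    - by apply: measurable_mxM => //; exact: measurable_mx_trmx.
    - by apply: filterS XiE_all => w h; rewrite !h.
    - by apply: measurable_mxM => //; exact: measurable_mx_trmx.
    - by apply: measurable_mxM => //; exact: measurable_mx_trmx.
    - by apply: filterS XiE_all => w h; rewrite !h.
  have beta_b : (beta_coef P X q <= b%:E)%E by rewrite beq.
  have D1' := D1; rewrite /D s2E in D1'.
  have := bounded_matrix_tail mXi' R0 Xi'_le Xi'_mean q_ge1 b0 beta_b t1 D1'.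
  rewrite -s2E -/D -/E; set A' := [set _ | _]; set B' := [set _ | _] => h.
  have mA' : measurable A'.
    by apply: measurable_spectral_norm_ge; apply: measurable_mx_sum => i; exact: mXiX'.
  have mB' : measurable B'.
    by apply: measurable_spectral_norm_ge; apply: measurable_mx_sum => i; exact: mXiX'.
  apply: (@le_trans _ _ (P A')).
    apply: le_measure_ae => //; apply: filterS XiE_all => w hw; rewrite /A /A' /=.
    by under [in X in _ -> X]eq_bigr do rewrite hw.
  apply: le_trans h _; rewrite EFinM leeD2r// leeD2l//.
  apply: le_measure_ae => //; apply: filterS XiE_all => w hw; rewrite /B /B' /=.
  by under [in X in X -> _]eq_bigr do rewrite hw.
(* If the mixing coefficient is [+oo], so is the right-hand side, since [n / q > 0] and no other
   term is [-oo]. *)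
have neq_ninfty (x : \bar R) : (0 <= x)%E -> x != -oo%E.
  by move=> x0; rewrite gt_eqF// (lt_le_trans _ x0)// ltNyr.
by move=> _ _; rewrite gt0_muley ?lte_fin// !addye ?leey// neq_ninfty.
Qed.
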